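(* The set $\mathcal{E}=\big\{f\in A(\mathbb{D}) : \beta(f)\notin \ell^1\big\}$ is a $G_\delta$ and dense subset of $A(\mathbb{D})$.
   Context: $\mathbb{D}$ is the open unit disc in $\mathbb{C}$. The disc algebra $A(\mathbb{D})$ is the set of functions $f:\overline{\mathbb{D}}\to\mathbb{C}$ that are continuous on $\overline{\mathbb{D}}$ and holomorphic on $\mathbb{D}$, with the supremum norm. For a holomorphic function $f$ on $\mathbb{D}$, $\beta(f)=(\beta_k(f))_{k=0}^\infty$ is the sequence of its Taylor coefficients at $0$, i.e. $f(z)=\sum_{k\ge0}\beta_k(f)z^k$. $\ell^1$ is the set of absolutely summable complex sequences. *)

(* Defs.v *)
From HB Require Import structures.
From mathcomp Require Import all_boot all_order all_algebra.
From mathcomp Require Import complex.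
From mathcomp Require Import all_classical all_reals all_analysis.

Set Implicit Arguments.
Unset Strict Implicit.
Unset Printing Implicit Defensive.

Import Order.TTheory GRing.Theory Num.Theory.
Import numFieldNormedType.Exports.

Local Open Scope classical_set_scope.
Local Open Scope ring_scope.

(* The norm topology is declared on numFieldTypes; this ascription makes it
   available on R[i]. *)
Definition Cplx (R : realType) : numFieldType := R[i].

Definition unit_disc (R : realType) : set (Cplx R) := [set z | `|z| < 1].
Arguments unit_disc : clear implicits.

Definition closed_unit_disc (R : realType) : set (Cplx R) :=
  [set z | `|z| <= 1].
Arguments closed_unit_disc : clear implicits.

(* Extension by 0 outside the closed disc. Derivatives at points of the open
   disc do not depend on the values outside. *)
Definition extend (R : realType) (f : closed_unit_disc R -> Cplx R) :
  Cplx R -> Cplx R := 'valL_0 f.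

(* As a type, this set carries the subspace topology of uniform convergence on
   the closed disc; [nbhs_disc_algebra] below checks that this is the topology
   of the supremum norm. *)
Definition disc_algebra (R : realType) :
    set {uniform closed_unit_disc R -> Cplx R} :=
  [set f | continuous (f : closed_unit_disc R -> Cplx R) /\
           forall z, unit_disc R z -> derivable (extend f) z 1].
Arguments disc_algebra : clear implicits.

(* [derive1n] is the iterated complex derivative, so these are the coefficients
   of the power series expansion at 0 when [f] is holomorphic near 0. *)
Definition taylor_coef (R : realType) (f : Cplx R -> Cplx R) : (Cplx R)^nat :=
  fun k => derive1n k f 0 / k`!%:R.

Definition l1 (R : realType) : set (Cplx R)^nat :=
  [set u : (Cplx R)^nat | cvgn [normed series u]].

Definition non_l1_taylor (R : realType) : set (disc_algebra R) :=
  [set f | ~ l1 (taylor_coef (extend (set_val f)))].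
Arguments non_l1_taylor : clear implicits.

(* Norms in R[i] are themselves elements of R[i] (with zero imaginary part),
   hence the projection [Re]. *)
Definition sup_norm (R : realType) (f : closed_unit_disc R -> Cplx R) :
    \bar R :=
  ereal_sup (range (fun z => (complex.Re (`|f z| : R[i]))%:E)).

Lemma nbhs_disc_algebra (R : realType) (f : disc_algebra R)
    (U : set (disc_algebra R)) :
  nbhs f U <-> exists2 e : R, 0 < e &
    forall g : disc_algebra R,
      (sup_norm (fun z => set_val f z - set_val g z)%R < e%:E)%E -> U g.
Proof.
have normE (z : Cplx R) : `|z| = (complex.Re (`|z| : R[i]))%:C%C :> R[i].
  by apply/eqP; rewrite eq_complex /= eqxx /=; case: z.
split.
- case=> _ [[/= V Vopen <-] Vf VU].
  have /uniform_nbhs[E [entE EV]] : nbhs (set_val f) V by exact: open_nbhs_nbhs.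
  move: entE; rewrite -entourage_ballE => -[e /= e0 eE].
  move: (e0); rewrite ltcE /= => /andP[/eqP Ime0 Ree0].
  exists (complex.Re e) => // g fg; apply: VU; apply: EV => z _; apply: eE => /=.
  rewrite -ball_normE /= [ltLHS]normE ltcE /= Ime0 eqxx /= -lte_fin.
  by apply: le_lt_trans fg; apply: ereal_sup_ubound; exists z.
- move=> [e e0 eU].
  have e20 : 0 < ((e / 2)%:C%C : Cplx R) by rewrite ltcE /= eqxx divr_gt0.
  pose B : set {uniform closed_unit_disc R -> Cplx R} :=
    [set h | forall z, setT z -> ball (set_val f z) ((e / 2)%:C%C : Cplx R) (h z)].
  have nB : nbhs (set_val f) B.
    apply/uniform_nbhs; exists [set xy | ball xy.1 ((e / 2)%:C%C : Cplx R) xy.2].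
    by split=> //; rewrite -entourage_ballE; exists ((e / 2)%:C%C).
  have : nbhs f (set_val @^-1` B).
    exact: (@initial_continuous (disc_algebra R) _ set_val f _ nB).
  apply: filterS => g fg; apply: eU.
  apply: (@le_lt_trans _ _ (e / 2)%:E).
    apply: ge_ereal_sup => _ [z _ <-]; rewrite lee_fin.
    have := fg z I; rewrite -ball_normE /= [X in X < _]normE ltcE /=.
    by case/andP => _ /ltW.
  by rewrite lte_fin ltr_pdivrMr // ltr_pMr // ltr1n.
Qed.

(* Main.v *)
Require Import Defs.
From mathcomp Require Import all_boot all_order all_algebra.
From mathcomp Require Import complex.
From mathcomp Require Import all_classical all_reals all_analysis.
From mathcomp Require Import borel_hierarchy.
From mathcomp Require Import ring lra.
Import Order.TTheory GRing.Theory Num.Theory.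
Import numFieldNormedType.Exports.

Set Implicit Arguments.
Unset Strict Implicit.
Unset Printing Implicit Defensive.

Local Open Scope classical_set_scope.
Local Open Scope ring_scope.

(** The two halves of the theorem use two facts of different nature.

    _G-delta._ The sequence [u] fails to be absolutely summable exactly when
    its absolute partial sums exceed every integer [N], so the exceptional set
    is the intersection over [N] of the sets where some absolute partial sum of
    Taylor coefficients exceeds [N]. Each of those sets is open as soon as
    every Taylor coefficient depends continuously on the function, for which a
    Cauchy estimate [|beta_n(f)| <= K_n sup |f|] suffices.

    Members of the disc algebra are only assumed to be complex differentiable
    at each point of the disc, whereas the Taylor coefficients are defined by
    iterated derivatives; hence Goursat's theorem is needed. It is proved for
    rectangles by bisection ([goursat]), then for functions with one point of
    mere continuity ([goursat_except]), which gives the Cauchy formula on the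
    square with vertices [(+-1 +-i)/2] ([cauchy_formula]). Expanding the kernel
    [1/(w - z)] in a geometric series yields a power series for [f] on
    [|z| < 1/2] whose coefficients are boundary integrals of [f]
    ([cauchy_series]); term by term differentiation ([pseries_derive1])
    identifies them with the Taylor coefficients. A square is enough because
    only the germ at 0 matters, and the constants [K_n] may be arbitrary.

    _Density._ It suffices to have a single [g] in the disc algebra with
    [beta(g)] not in [l^1]: if [beta(f)] is in [l^1], then [beta(f + t g)] is
    not, for every [t <> 0]. The function used here is the sum over [j] of
    [4^-j z^(4^j) P_(2j)(z)], where [P_k] is the Rudin-Shapiro polynomial. It
    has [2^k] coefficients [+-1], but modulus at most [sqrt(2^(k+1))] on the
    closed disc. Thus the [j]-th block has norm at most [2 * 2^-j], which makes
    the series uniformly convergent, while the coefficients of that block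
    contribute [4^j * 4^-j = 1] to the [l^1] norm; as the blocks do not
    overlap, the total is infinite. *)

(** * Real-valued modulus on the complex numbers *)

Section Modulus.
Context {R : realType}.
Local Notation C := (Cplx R).
Implicit Types (x y : R) (z w : C).

Definition rp z : R := complex.Re z.
Definition ip z : R := complex.Im z.
Definition toC x : C := (x%:C)%C.
Definition iC : C := ('i)%C.
(** The norm of [R[i]] takes values in [R[i]], where the order is partial;
    inequalities between moduli are therefore stated in [R]. *)
Definition nrm z : R := complex.Re (`|z| : R[i]).

Lemma normE z : `|z| = toC (nrm z).
Proof. by apply/eqP; rewrite eq_complex /= eqxx /=; case: z. Qed.

Lemma toC_inj : injective toC. Proof. by move=> x y []. Qed.
Lemma toC0 : toC 0 = 0. Proof. by []. Qed.
Lemma toC1 : toC 1 = 1. Proof. by []. Qed.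
Lemma toCD x y : toC (x + y) = toC x + toC y. Proof. exact: (rmorphD (real_complex R)). Qed.
Lemma toCB x y : toC (x - y) = toC x - toC y. Proof. exact: (rmorphB (real_complex R)). Qed.
Lemma toCM x y : toC (x * y) = toC x * toC y. Proof. exact: (rmorphM (real_complex R)). Qed.
Lemma toCV x : toC x^-1 = (toC x)^-1. Proof. exact: (fmorphV (real_complex R)). Qed.
Lemma toCX x n : toC (x ^+ n) = toC x ^+ n. Proof. exact: (rmorphXn (real_complex R)). Qed.
Lemma toC_nat n : toC n%:R = n%:R. Proof. exact: (rmorph_nat (real_complex R)). Qed.
Lemma le_toC x y : (toC x <= toC y) = (x <= y). Proof. exact: lecR. Qed.
Lemma lt_toC x y : (toC x < toC y) = (x < y). Proof. exact: ltcR. Qed.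

Lemma rpip z : z = toC (rp z) + iC * toC (ip z).
Proof. exact: complexE. Qed.
Lemma rpD z w : rp (z + w) = rp z + rp w. Proof. by case: z; case: w. Qed.
Lemma ipD z w : ip (z + w) = ip z + ip w. Proof. by case: z; case: w. Qed.
Lemma rpN z : rp (- z) = - rp z. Proof. by case: z. Qed.
Lemma ipN z : ip (- z) = - ip z. Proof. by case: z. Qed.
Lemma rpB z w : rp (z - w) = rp z - rp w. Proof. by rewrite rpD rpN. Qed.
Lemma ipB z w : ip (z - w) = ip z - ip w. Proof. by rewrite ipD ipN. Qed.
Lemma rpM z w : rp (z * w) = rp z * rp w - ip z * ip w.
Proof. by case: z => a b; case: w. Qed.
Lemma ipM z w : ip (z * w) = rp z * ip w + ip z * rp w.
Proof. by case: z => a b; case: w. Qed.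
Lemma rp_toC x : rp (toC x) = x. Proof. by []. Qed.
Lemma ip_toC x : ip (toC x) = 0. Proof. by []. Qed.
Lemma rp_i : rp iC = 0. Proof. by []. Qed.
Lemma ip_i : ip iC = 1. Proof. by []. Qed.
Lemma iC_sqr : iC * iC = -1. Proof. by rewrite -expr2 (sqr_i R). Qed.
Definition riE := (rpB, ipB, rpD, ipD, rpN, ipN, rpM, ipM, rp_toC, ip_toC, rp_i, ip_i).
Lemma ri_ext z w : rp z = rp w -> ip z = ip w -> z = w.
Proof. by move=> a b; rewrite (rpip z) (rpip w) a b. Qed.

Lemma nrm_ge0 z : 0 <= nrm z.
Proof. by rewrite -le_toC -normE normr_ge0. Qed.
Lemma nrmD z w : nrm (z + w) <= nrm z + nrm w.
Proof. by rewrite -le_toC toCD -!normE ler_normD. Qed.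
Lemma nrmM z w : nrm (z * w) = nrm z * nrm w.
Proof. by apply: toC_inj; rewrite toCM -!normE normrM. Qed.
Lemma nrmN z : nrm (- z) = nrm z.
Proof. by apply: toC_inj; rewrite -!normE normrN. Qed.
Lemma nrmC z w : nrm (z - w) = nrm (w - z).
Proof. by rewrite -nrmN opprB. Qed.
Lemma nrmV z : nrm z^-1 = (nrm z)^-1.
Proof. by apply: toC_inj; rewrite toCV -!normE normfV. Qed.
Lemma nrmX z n : nrm (z ^+ n) = nrm z ^+ n.
Proof. by apply: toC_inj; rewrite toCX -!normE normrX. Qed.
Lemma nrm0 : nrm 0 = 0.
Proof. by apply: toC_inj; rewrite -normE normr0. Qed.
Lemma nrm1 : nrm 1 = 1.
Proof. by apply: toC_inj; rewrite -normE normr1. Qed.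
Lemma nrm_toC x : nrm (toC x) = `|x|.
Proof.
rewrite /nrm normc_def /= expr0n /= addr0.
by rewrite sqrtr_sqr.
Qed.
Lemma nrm_iC : nrm iC = 1.
Proof. by rewrite /nrm normc_def /= expr0n expr1n add0r sqrtr1. Qed.
Lemma nrm_nat n : nrm n%:R = n%:R.
Proof. by rewrite -toC_nat nrm_toC normr_nat. Qed.
Lemma nrm_eq0 z : (nrm z == 0) = (z == 0).
Proof. by rewrite -(inj_eq toC_inj) -normE normr_eq0. Qed.
Lemma nrm_gt0 z : (0 < nrm z) = (z != 0).
Proof. by rewrite lt_neqAle nrm_ge0 andbT eq_sym nrm_eq0. Qed.
Lemma nrmB z w : nrm (z - w) <= nrm z + nrm w.
Proof. by rewrite -(nrmN w) nrmD. Qed.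
Lemma nrm_lbB z w : nrm z - nrm w <= nrm (z - w).
Proof. by rewrite lerBlDr -{1}(subrK w z) nrmD. Qed.
Lemma rp_le z : `|rp z| <= nrm z.
Proof. by rewrite -le_toC -normE; exact: normc_ge_Re. Qed.
Lemma ip_le z : `|ip z| <= nrm z.
Proof.
have := rp_le (iC * z); rewrite nrmM nrm_iC mul1r !riE mul0r mul1r sub0r.
by rewrite normrN.
Qed.
Lemma nrm_le_ri z : nrm z <= `|rp z| + `|ip z|.
Proof. by rewrite {1}(rpip z) (le_trans (nrmD _ _))// nrmM nrm_iC mul1r !nrm_toC. Qed.
Lemma nrm_sqr z : nrm z ^+ 2 = rp z ^+ 2 + ip z ^+ 2.
Proof.
by rewrite /nrm normc_def /= sqr_sqrtr // addr_ge0 // sqr_ge0.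
Qed.
Lemma nrm_sum (I : Type) (r : seq I) (P : pred I) (F : I -> C) :
  nrm (\sum_(i <- r | P i) F i) <= \sum_(i <- r | P i) nrm (F i).
Proof.
elim/big_rec2: _ => [|i y1 y2 _ h]; first by rewrite nrm0.
by rewrite (le_trans (nrmD _ _))// lerD2l.
Qed.
Lemma nrm_small z : (forall e : R, 0 < e -> nrm z <= e) -> z = 0.
Proof.
move=> h; apply/eqP; rewrite -nrm_eq0; apply/negPn/negP => zn.
have z0 : 0 < nrm z by rewrite lt_neqAle eq_sym zn nrm_ge0.
have := h (nrm z / 2) ltac:(lra); lra.
Qed.

End Modulus.

(* From here on every structure on [Cplx R] comes from its instance of
   numFieldType, and never from the representation as pairs. *)
Opaque Cplx.

(** * Complex derivatives *)

Section Derivative.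
Context {R : realType}.
Local Notation C := (Cplx R).
Implicit Types (F G : C -> C) (z w l : C).

Definition ccont F z := forall e : R, 0 < e ->
  exists2 d : R, 0 < d & forall w, nrm (w - z) < d -> nrm (F w - F z) <= e.

(** Clearing the denominator keeps the estimate valid at [w = z], where the
    difference quotient is undefined. *)
Definition cder F z l := forall e : R, 0 < e ->
  exists2 d : R, 0 < d & forall w, nrm (w - z) < d ->
    nrm (F w - F z - l * (w - z)) <= e * nrm (w - z).

Lemma quotient_errorE (K : fieldType) (h A l : K) : h != 0 ->
  A - l * h = h * (h^-1 * A - l).
Proof. by move=> h0; field. Qed.

Lemma quotient_errorV (K : fieldType) (h A l : K) : h != 0 ->
  h^-1 * A - l = h^-1 * (A - l * h).
Proof. by move=> h0; field. Qed.

Lemma derivable_cder F z : derivable F z 1 -> cder F z (derive1 F z).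
Proof.
move=> dF e e0.
have /cvgrPdist_le/(_ (toC e)) := (dF : cvg _).
have -> : lim ((fun h : C => h^-1 *: (F (h *: 1 + z) - F z)) @ 0^') = derive1 F z.
  by rewrite derive1E.
rewrite -toC0 lt_toC => /(_ e0).
rewrite toC0 => /nbhs_ballP[d /= d0 hd].
have d0' : 0 < nrm d.
  by rewrite nrm_gt0 gt_eqF.
have dE : d = toC (nrm d) by rewrite -normE gtr0_norm.
exists (nrm d) => // w wz.
have [->|wnz] := eqVneq w z; first by rewrite !subrr mulr0 subr0 nrm0 mulr0.
have wz0 : w - z != 0 by rewrite subr_eq0.
have := hd (w - z); rewrite /ball /= sub0r normrN normE [X in _ < X]dE lt_toC.
move=> /(_ wz wz0); rewrite [(w - z) *: 1]mulr1 subrK.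
rewrite normE le_toC => h.
rewrite nrmC in h; rewrite [X in nrm X <= _](_ : _ =
   (w - z) * ((w - z)^-1 *: (F w - F z) - derive1 F z)); last first.
  exact: quotient_errorE.
by rewrite nrmM mulrC ler_wpM2r // nrm_ge0.
Qed.

Lemma cder_derivable F z l : cder F z l -> derivable F z 1 /\ derive1 F z = l.
Proof.
move=> dF.
have h : (fun h : C => h^-1 *: (F (h *: 1 + z) - F z)) @ 0^' --> l.
  apply/cvgrPdist_le => e e0.
  have eE : e = toC (nrm e) by rewrite -normE gtr0_norm.
  have e0' : 0 < nrm e by rewrite nrm_gt0 gt_eqF.
  have [d d0 hd] := dF _ e0'.
  apply/nbhs_ballP.
  exists (toC d); first by rewrite /= -toC0 lt_toC.
  move=> h; rewrite /ball /= sub0r normrN normE lt_toC => hh h0.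
  have := hd (h + z); rewrite addrK => /(_ hh) => hle.
  rewrite [h *: 1]mulr1 normE eE le_toC -nrmN opprB.
  rewrite [X in nrm X <= _](_ : _ = h^-1 * (F (h + z) - F z - l * h)); last first.
    exact: quotient_errorV.
  by rewrite nrmM nrmV mulrC ler_pdivrMr // nrm_gt0.
split; first by apply/cvg_ex; exists l.
by rewrite derive1E; apply: cvg_lim h => //; exact: Rhausdorff.
Qed.
Lemma cder_cont F z l : cder F z l -> ccont F z.
Proof.
move=> dF e e0.
have [d d0 hd] := dF 1 ltr01.
have n0 := nrm_ge0 l.
exists (Num.min d (e / (1 + nrm l))); first by rewrite lt_min d0 divr_gt0 //; lra.
move=> w; rewrite lt_min ltr_pdivlMr; last lra.
move=> /andP[/hd h1 h2].
rewrite -(subrK (l * (w - z)) (F w - F z)).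
apply: (le_trans (nrmD _ _)); rewrite nrmM; lra.
Qed.

Lemma eq_near_cder F G z l : (exists2 d : R, 0 < d & forall w, nrm (w - z) < d -> F w = G w) ->
  cder F z l -> cder G z l.
Proof.
move=> [d d0 h] dF e /dF[d' d'0 hd].
exists (Num.min d d'); first by rewrite lt_min d0.
move=> w; rewrite lt_min => /andP[wd wd'].
by rewrite -h // -h ?hd // subrr nrm0.
Qed.

Lemma ccontP F z : ccont F z <-> {for z, continuous F}.
Proof.
split=> [cF|].
  apply/(@cvgrPdist_le _ _ _ (nbhs z) (nbhs_filter z)) => e e0.
  have eE : e = toC (nrm e) by rewrite -normE gtr0_norm.
  have e0' : 0 < nrm e by rewrite nrm_gt0 gt_eqF.
  have [d d0 hd] := cF _ e0'.
  apply/nbhs_ballP; exists (toC d); first by rewrite /= -toC0 lt_toC.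
  move=> w; rewrite /ball /= distrC normE lt_toC => /hd.
  by rewrite distrC normE [X in _ -> _ <= X]eE le_toC.
move=> h e e0; have := (@cvgrPdist_le _ _ _ (nbhs z) (nbhs_filter z) _ _).1 h (toC e).
rewrite -toC0 lt_toC => /(_ e0) /nbhs_ballP[d /= d0 hd].
have d0' : 0 < nrm d by rewrite nrm_gt0 gt_eqF.
have dE : d = toC (nrm d) by rewrite -normE gtr0_norm.
exists (nrm d) => // w wz; have := hd w.
rewrite /ball /= distrC normE [X in _ < X]dE lt_toC => /(_ wz).
by rewrite distrC normE le_toC.
Qed.

Lemma cderP F z l : cder F z l <-> is_derive z 1 F l.
Proof.
split=> [/cder_derivable[dF <-]|[dF <-]].
  by rewrite derive1E; exact: DeriveDef.
by rewrite -derive1E; exact: derivable_cder.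
Qed.

Lemma cderD F G z l m : cder F z l -> cder G z m ->
  cder (fun w => F w + G w) z (l + m).
Proof. by move=> /cderP dF /cderP dG; apply/cderP; exact: is_deriveD. Qed.

Lemma cderB F G z l m : cder F z l -> cder G z m ->
  cder (fun w => F w - G w) z (l - m).
Proof. by move=> /cderP dF /cderP dG; apply/cderP; exact: is_deriveB. Qed.

Lemma cderM F G z l m : cder F z l -> cder G z m ->
  cder (fun w => F w * G w) z (F z * m + G z * l).
Proof. by move=> /cderP dF /cderP dG; apply/cderP; exact: is_deriveM. Qed.

Lemma cder_cst c z : cder (fun=> c) z 0.
Proof. by apply/cderP; exact: is_derive_cst. Qed.

Lemma cder_id z : cder id z 1.
Proof. by apply/cderP; exact: is_derive_id. Qed.

Lemma cderV F z l : F z != 0 -> cder F z l ->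
  cder (fun w => (F w)^-1) z (- (F z) ^- 2 * l).
Proof.
move=> F0 /cderP[dF <-]; apply/cderP; split; first exact: derivableV.
exact: deriveV.
Qed.

Lemma cderX F n z l : cder F z l ->
  cder (fun w => F w ^+ n.+1) z (n.+1%:R * F z ^+ n * l).
Proof.
move=> dF; elim: n => [|n ih]; first by rewrite expr0 mulr1 mul1r.
have := cderM dF ih; rewrite [X in cder _ _ X](_ : _ = n.+2%:R * F z ^+ n.+1 * l).
  by rewrite (_ : (fun w => F w * F w ^+ n.+1) = (fun w => F w ^+ n.+2)).
by rewrite -[in RHS]natr1 exprS; ring.
Qed.

Lemma ccontD F G z : ccont F z -> ccont G z -> ccont (fun w => F w + G w) z.
Proof. by move=> /ccontP cF /ccontP cG; apply/ccontP; exact: (continuousD cF cG). Qed.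
Lemma ccontB F G z : ccont F z -> ccont G z -> ccont (fun w => F w - G w) z.
Proof. by move=> /ccontP cF /ccontP cG; apply/ccontP; exact: (continuousB cF cG). Qed.
Lemma ccontM F G z : ccont F z -> ccont G z -> ccont (fun w => F w * G w) z.
Proof. by move=> /ccontP cF /ccontP cG; apply/ccontP; exact: (continuousM cF cG). Qed.

End Derivative.

(** * Integrals of complex-valued functions of a real variable *)

Section ComplexIntegral.
Context {R : realType}.
Local Notation C := (Cplx R).
Local Notation mu := (@lebesgue_measure R).
Implicit Types (phi psi Phi : R -> C) (a b t : R) (l : C).

Definition path_cont phi t := forall e : R, 0 < e ->
  exists2 d : R, 0 < d & forall t', `|t' - t| < d -> nrm (phi t' - phi t) <= e.

Definition segment_cont phi a b := forall t, a <= t <= b -> path_cont phi t.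

Definition path_deriv phi t l := forall e : R, 0 < e ->
  exists2 d : R, 0 < d & forall t', `|t' - t| < d ->
    nrm (phi t' - phi t - toC (t' - t) * l) <= e * `|t' - t|.

Definition path_int phi a b : C :=
  toC (\int[mu]_(t in `[a, b]) rp (phi t))%R +
  iC * toC (\int[mu]_(t in `[a, b]) ip (phi t))%R.

Lemma within_cont_dist phi (u : R -> R) a b :
  (forall s t, `|u s - u t| <= nrm (phi s - phi t)) ->
  segment_cont phi a b -> {within `[a, b], continuous u}.
Proof.
move=> hu cphi; apply: continuous_in_subspaceT => t.
rewrite inE /= in_itv /= => /cphi ct.
apply/cvgrPdist_le => e e0; have [d d0 hd] := ct e e0.
apply/nbhs_ballP; exists d => // t' /=; rewrite /ball /= distrC => /hd.
by rewrite distrC; apply: le_trans.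
Qed.

Lemma rp_dist phi s t : `|rp (phi s) - rp (phi t)| <= nrm (phi s - phi t).
Proof. by rewrite -rpB rp_le. Qed.
Lemma ip_dist phi s t : `|ip (phi s) - ip (phi t)| <= nrm (phi s - phi t).
Proof. by rewrite -ipB ip_le. Qed.

Lemma integrable_dist phi (u : R -> R) a b :
  (forall s t, `|u s - u t| <= nrm (phi s - phi t)) ->
  segment_cont phi a b -> mu.-integrable `[a, b] (EFin \o u).
Proof.
move=> hu cphi; apply: continuous_compact_integrable.
  exact: segment_compact.
exact: within_cont_dist cphi.
Qed.

Lemma integrable_rp phi a b : segment_cont phi a b ->
  mu.-integrable `[a, b] (EFin \o (fun t => rp (phi t))).
Proof. by apply: integrable_dist => s t; exact: rp_dist. Qed.
Lemma integrable_ip phi a b : segment_cont phi a b ->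
  mu.-integrable `[a, b] (EFin \o (fun t => ip (phi t))).
Proof. by apply: integrable_dist => s t; exact: ip_dist. Qed.

Lemma rp_path_int phi a b : rp (path_int phi a b) = (\int[mu]_(t in `[a, b]) rp (phi t))%R.
Proof. by rewrite /path_int !riE; ring. Qed.
Lemma ip_path_int phi a b : ip (path_int phi a b) = (\int[mu]_(t in `[a, b]) ip (phi t))%R.
Proof. by rewrite /path_int !riE; ring. Qed.

Lemma RintegralZD (u v : R -> R) (a b x y : R) :
  mu.-integrable `[a, b] (EFin \o u) -> mu.-integrable `[a, b] (EFin \o v) ->
  (\int[mu]_(t in `[a, b]) (x * u t + y * v t) =
   x * (\int[mu]_(t in `[a, b]) u t) + y * \int[mu]_(t in `[a, b]) v t)%R.
Proof.
move=> iu iv; rewrite RintegralD //.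
- by rewrite !RintegralZl.
- by have := integrableZl _ x iu; apply.
- by have := integrableZl _ y iv; apply.
Qed.

Lemma path_intD phi psi a b : segment_cont phi a b -> segment_cont psi a b ->
  path_int (fun t => phi t + psi t) a b = path_int phi a b + path_int psi a b.
Proof.
move=> c1 c2; apply: ri_ext; [rewrite [RHS]rpD !rp_path_int|rewrite [RHS]ipD !ip_path_int].
  under eq_Rintegral do rewrite rpD.
  by rewrite RintegralD //; exact: integrable_rp.
under eq_Rintegral do rewrite ipD.
by rewrite RintegralD //; exact: integrable_ip.
Qed.

Lemma path_intZ l phi a b : segment_cont phi a b ->
  path_int (fun t => l * phi t) a b = l * path_int phi a b.
Proof.
move=> c1; apply: ri_ext; [rewrite [RHS]rpM|rewrite [RHS]ipM]; rewrite ?rp_path_int ?ip_path_int.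
  under eq_Rintegral do rewrite rpM -mulNr.
  by rewrite RintegralZD ?mulNr //; [exact: integrable_rp|exact: integrable_ip].
under eq_Rintegral do rewrite ipM.
by rewrite RintegralZD //; [exact: integrable_ip|exact: integrable_rp].
Qed.

Lemma eq_path_int phi psi a b : (forall t, a <= t <= b -> phi t = psi t) ->
  path_int phi a b = path_int psi a b.
Proof.
by move=> h; rewrite /path_int; congr (toC _ + iC * toC _); apply: eq_Rintegral => t;
  rewrite inE /= in_itv /= => /h ->.
Qed.

Lemma path_int_split phi a e b : a <= e <= b -> segment_cont phi a b ->
  path_int phi a b = path_int phi a e + path_int phi e b.
Proof.
move=> /andP[ae eb] cphi.
have key (u : R -> R) : mu.-integrable `[a, b] (EFin \o u) ->
   (\int[mu]_(t in `[a, b]) u t = (\int[mu]_(t in `[a, e]) u t) + \int[mu]_(t in `[e, b]) u t)%R.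
  move=> iu; rewrite -(@Rintegral_itv_obnd_cbnd _ e); last first.
    apply: integrableS iu => //.
    by apply: subset_itv; rewrite bnd_simp.
  by rewrite -(@Rintegral_itvB _ _ (BLeft a) (BRight b)) ?bnd_simp //; ring.
apply: ri_ext; [rewrite [RHS]rpD !rp_path_int|rewrite [RHS]ipD !ip_path_int];
  apply: key.
  exact: integrable_rp.
exact: integrable_ip.
Qed.

(** Bounding the real and the imaginary part separately costs the factor 2,
    which is harmless: no sharp estimate is used anywhere. *)
Lemma path_int_bound phi a b (M : R) : a <= b -> segment_cont phi a b ->
  (forall t, a <= t <= b -> nrm (phi t) <= M) ->
  nrm (path_int phi a b) <= 2 * M * (b - a).
Proof.
move=> ab cphi hM.
have key (u : R -> R) : mu.-integrable `[a, b] (EFin \o u) ->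
   (forall t, `|u t| <= nrm (phi t)) ->
   `|(\int[mu]_(t in `[a, b]) u t)%R| <= M * (b - a).
  move=> iu hu; apply: (le_trans (le_normr_Rintegral _ _)) => //.
  have -> : M * (b - a) = (\int[mu]_(t in `[a, b]) (cst M t))%R.
    rewrite Rintegral_cst //= lebesgue_measure_itv /= lte_fin.
    case: ltP => //= ba; have -> : a = b by apply/eqP; rewrite eq_le ab.
    by rewrite subrr mulr0.
  apply: le_Rintegral => //.
  - exact: (integrable_norm iu).
  - apply: continuous_compact_integrable; first exact: segment_compact.
    by move=> t; exact: cvg_cst.
  - by move=> t /=; rewrite in_itv /= => /hM; exact: le_trans.
apply: (le_trans (nrm_le_ri _)); rewrite rp_path_int ip_path_int.
have h1 := key _ (integrable_rp cphi) (fun t => rp_le (phi t)).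
have h2 := key _ (integrable_ip cphi) (fun t => ip_le (phi t)).
by rewrite -mulrA; lra.
Qed.

Lemma path_deriv_cont phi t l : path_deriv phi t l -> path_cont phi t.
Proof.
move=> dF e e0.
have [d d0 hd] := dF 1 ltr01.
have n0 := nrm_ge0 l.
exists (Num.min d (e / (1 + nrm l))); first by rewrite lt_min d0 divr_gt0 //; lra.
move=> w; rewrite lt_min ltr_pdivlMr; last lra.
move=> /andP[/hd h1 h2].
rewrite -(subrK (toC (w - t) * l) (phi w - phi t)).
apply: (le_trans (nrmD _ _)); rewrite nrmM nrm_toC; lra.
Qed.

Lemma real_derivable (u : R -> R) t (x : R) :
  (forall e : R, 0 < e -> exists2 d : R, 0 < d & forall t', `|t' - t| < d ->
    `|u t' - u t - (t' - t) * x| <= e * `|t' - t|) ->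
  derivable u t 1 /\ derive1 u t = x.
Proof.
move=> hu.
have h : (fun h : R => h^-1 *: (u (h *: 1 + t) - u t)) @ 0^' --> x.
  apply/cvgrPdist_le => e e0.
  have [d d0 hd] := hu _ e0.
  apply/nbhs_ballP; exists d => //= h; rewrite /ball /= sub0r normrN => hh h0.
  have := hd (h + t); rewrite addrK => /(_ hh) => hle.
  rewrite [h *: 1]mulr1 distrC.
  rewrite [X in `|X| <= _](_ : _ = h^-1 * (u (h + t) - u t - h * x)); last first.
    by rewrite (mulrC h x); exact: quotient_errorV.
  by rewrite normrM normfV mulrC ler_pdivrMr // normr_gt0.
split; first by apply/cvg_ex; exists x.
by rewrite derive1E; apply: cvg_lim h => //; exact: Rhausdorff.
Qed.

Lemma path_int_FTC phi Phi a b : a <= b -> segment_cont phi a b ->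
  (forall t, a <= t <= b -> path_deriv Phi t (phi t)) ->
  path_int phi a b = Phi b - Phi a.
Proof.
move=> ab cphi dPhi.
have cPhi : segment_cont Phi a b by move=> t /dPhi; exact: path_deriv_cont.
have key (p : C -> R) : (forall z w, p (z - w) = p z - p w) ->
    (forall x z, p (toC x * z) = x * p z) -> (forall z, `|p z| <= nrm z) ->
    (\int[mu]_(t in `[a, b]) p (phi t))%R = p (Phi b) - p (Phi a).
  move=> pB pZ ple.
  move: (ab); rewrite le_eqVlt => /predU1P[<-|altb].
    by rewrite set_itv1 Rintegral_set1 subrr.
  have pd s t : `|p (phi s) - p (phi t)| <= nrm (phi s - phi t) by rewrite -pB.
  have pD s t : `|p (Phi s) - p (Phi t)| <= nrm (Phi s - Phi t) by rewrite -pB.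
  have dp t : a <= t <= b -> derivable (fun t => p (Phi t)) t 1 /\
       derive1 (fun t => p (Phi t)) t = p (phi t).
    move=> /dPhi dt; apply: real_derivable => e e0.
    have [d d0 hd] := dt e e0; exists d => // t' /hd.
    by apply: le_trans; rewrite -pZ -!pB.
  rewrite /Rintegral (@continuous_FTC2 _ _ (fun t => p (Phi t))) //.
  - exact: (within_cont_dist pd).
  - have wc := within_cont_dist pD cPhi.
    have /(continuous_within_itvP _ altb)[_ c1 c2] := wc.
    split => // t; rewrite in_itv /= => /andP[/ltW h1 /ltW h2].
    by have [] := dp t; rewrite ?h1 ?h2.
  - move=> t; rewrite in_itv /= => /andP[/ltW h1 /ltW h2].
    by have [] := dp t; rewrite ?h1 ?h2.
apply: ri_ext; [rewrite [RHS]rpB rp_path_int|rewrite [RHS]ipB ip_path_int];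
  apply: key.
- exact: rpB.
- by move=> x z; rewrite !riE; ring.
- exact: rp_le.
- exact: ipB.
- by move=> x z; rewrite !riE; ring.
- exact: ip_le.
Qed.

End ComplexIntegral.

(** * Contour integrals over rectangles *)

Section Contour.
Context {R : realType}.
Local Notation C := (Cplx R).
Implicit Types (F G Phi : C -> C) (a b c d x y : R) (l w z : C).

Definition pt x y : C := toC x + iC * toC y.

Lemma pt_rpip z : pt (rp z) (ip z) = z. Proof. by rewrite {3}(rpip z). Qed.
Lemma rp_pt x y : rp (pt x y) = x. Proof. by rewrite /pt !riE; ring. Qed.
Lemma ip_pt x y : ip (pt x y) = y. Proof. by rewrite /pt !riE; ring. Qed.
Lemma ptBx x x' y : pt x y - pt x' y = toC (x - x').
Proof. by rewrite /pt toCB; ring. Qed.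
Lemma ptBy x y y' : pt x y - pt x y' = iC * toC (y - y').
Proof. by rewrite /pt toCB; ring. Qed.
Lemma nrm_ptBx x x' y : nrm (pt x y - pt x' y) = `|x - x'|.
Proof. by rewrite ptBx nrm_toC. Qed.
Lemma nrm_ptBy x y y' : nrm (pt x y - pt x y') = `|y - y'|.
Proof. by rewrite ptBy nrmM nrm_iC mul1r nrm_toC. Qed.

(** The boundary is run counterclockwise; the factors [iC] are the velocities of
    the vertical sides. *)
Definition contour F a b c d : C :=
  path_int (fun x => F (pt x c)) a b + iC * path_int (fun y => F (pt b y)) c d
  - path_int (fun x => F (pt x d)) a b - iC * path_int (fun y => F (pt a y)) c d.

Definition on_rect (P : C -> Prop) a b c d :=
  forall x y, a <= x <= b -> c <= y <= d -> P (pt x y).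

Definition on_boundary (P : C -> Prop) a b c d :=
  [/\ forall x, a <= x <= b -> P (pt x c), forall x, a <= x <= b -> P (pt x d),
      forall y, c <= y <= d -> P (pt a y) & forall y, c <= y <= d -> P (pt b y)].

Lemma on_rect_boundary P a b c d : a <= b -> c <= d ->
  on_rect P a b c d -> on_boundary P a b c d.
Proof. by move=> ab cd h; split=> *; apply: h; rewrite ?lexx ?ab ?cd. Qed.

Lemma on_rect_imp (P Q : C -> Prop) a b c d :
  (forall w, P w -> Q w) -> on_rect P a b c d -> on_rect Q a b c d.
Proof. by move=> h h1 x y hx hy; apply: h; exact: h1. Qed.

Lemma ccont_x F x y : ccont F (pt x y) -> path_cont (fun x => F (pt x y)) x.
Proof.
by move=> cF e /cF[d d0 hd]; exists d => // x' h; apply: hd; rewrite nrm_ptBx.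
Qed.
Lemma ccont_y F x y : ccont F (pt x y) -> path_cont (fun y => F (pt x y)) y.
Proof.
by move=> cF e /cF[d d0 hd]; exists d => // x' h; apply: hd; rewrite nrm_ptBy.
Qed.

Lemma edge_contx F a b y : (forall x, a <= x <= b -> ccont F (pt x y)) ->
  segment_cont (fun x => F (pt x y)) a b.
Proof. by move=> h x /h /ccont_x. Qed.
Lemma edge_conty F c d x : (forall y, c <= y <= d -> ccont F (pt x y)) ->
  segment_cont (fun y => F (pt x y)) c d.
Proof. by move=> h y /h /ccont_y. Qed.

Lemma contourD F G a b c d :
  on_boundary (ccont F) a b c d -> on_boundary (ccont G) a b c d ->
  contour (fun w => F w + G w) a b c d = contour F a b c d + contour G a b c d.
Proof.
move=> [f1 f2 f3 f4] [g1 g2 g3 g4]; rewrite /contour.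
rewrite (path_intD (edge_contx f1) (edge_contx g1)) (path_intD (edge_contx f2) (edge_contx g2)).
rewrite (path_intD (edge_conty f3) (edge_conty g3)) (path_intD (edge_conty f4) (edge_conty g4)).
ring.
Qed.

Lemma contourZ l F a b c d : on_boundary (ccont F) a b c d ->
  contour (fun w => l * F w) a b c d = l * contour F a b c d.
Proof.
move=> [f1 f2 f3 f4]; rewrite /contour.
rewrite (path_intZ _ (edge_contx f1)) (path_intZ _ (edge_contx f2)).
rewrite (path_intZ _ (edge_conty f3)) (path_intZ _ (edge_conty f4)); ring.
Qed.

Lemma eq_contour F G a b c d : on_boundary (fun w => F w = G w) a b c d ->
  contour F a b c d = contour G a b c d.
Proof.
move=> [f1 f2 f3 f4]; rewrite /contour.
by rewrite (eq_path_int f1) (eq_path_int f2) (eq_path_int f3) (eq_path_int f4).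
Qed.

Lemma contour_bound F a b c d (M : R) : a <= b -> c <= d ->
  on_boundary (ccont F) a b c d ->
  on_boundary (fun w => nrm (F w) <= M) a b c d ->
  nrm (contour F a b c d) <= 4 * M * ((b - a) + (d - c)).
Proof.
move=> ab cd [f1 f2 f3 f4] [g1 g2 g3 g4]; rewrite /contour.
have := path_int_bound ab (edge_contx f1) g1.
have := path_int_bound ab (edge_contx f2) g2.
have := path_int_bound cd (edge_conty f3) g3.
have := path_int_bound cd (edge_conty f4) g4.
set i1 := path_int _ _ _; set i2 := path_int _ _ _.
set i3 := path_int _ _ _; set i4 := path_int _ _ _.
move=> h1 h2 h3 h4.
have := nrmB (i4 + iC * i1 - i3) (iC * i2).
have := nrmB (i4 + iC * i1) i3.
have := nrmD i4 (iC * i1).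
rewrite !nrmM !nrm_iC !mul1r.
move: h1 h2 h3 h4; rewrite !mulrDr !mulrN; lra.
Qed.

(** The common side of the two pieces is run once in each direction. *)
Lemma contour_splitx F a e b c d : a <= e <= b -> c <= d ->
  on_rect (ccont F) a b c d ->
  contour F a b c d = contour F a e c d + contour F e b c d.
Proof.
move=> aeb cd cF; rewrite /contour.
rewrite !(path_int_split aeb); first ring.
all: by apply: edge_contx => x hx; apply: cF; rewrite ?lexx ?cd.
Qed.

Lemma contour_splity F a b c e d : a <= b -> c <= e <= d ->
  on_rect (ccont F) a b c d ->
  contour F a b c d = contour F a b c e + contour F a b e d.
Proof.
move=> ab ced cF; rewrite /contour.
rewrite !(path_int_split ced); first ring.
all: by apply: edge_conty => x hx; apply: cF; rewrite ?lexx ?ab.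
Qed.

(** On each side the integral is the increment of the primitive, and the four
    increments telescope around the closed contour. *)
Lemma contour_primitive F Phi a b c d : a <= b -> c <= d ->
  on_boundary (ccont F) a b c d ->
  on_boundary (fun w => cder Phi w (F w)) a b c d ->
  contour F a b c d = 0.
Proof.
move=> ab cd [f1 f2 f3 f4] [g1 g2 g3 g4]; rewrite /contour.
have hx y : (forall x, a <= x <= b -> ccont F (pt x y)) ->
    (forall x, a <= x <= b -> cder Phi (pt x y) (F (pt x y))) ->
    path_int (fun x => F (pt x y)) a b = Phi (pt b y) - Phi (pt a y).
  move=> cF dP; apply: (path_int_FTC (Phi := fun x => Phi (pt x y))) => //.
    exact: edge_contx.
  move=> t /dP dt e /dt[r r0 hr]; exists r => // t' tt'.
  have := hr (pt t' y); rewrite nrm_ptBx ptBx => /(_ tt').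
  by rewrite mulrC.
have hy x : (forall y, c <= y <= d -> ccont F (pt x y)) ->
    (forall y, c <= y <= d -> cder Phi (pt x y) (F (pt x y))) ->
    iC * path_int (fun y => F (pt x y)) c d = Phi (pt x d) - Phi (pt x c).
  move=> cF dP; rewrite -path_intZ; last exact: edge_conty.
  apply: (path_int_FTC (Phi := fun y => Phi (pt x y))) => //.
    move=> t ht e e0; have [r r0 hr] := ccont_y (cF t ht) e0.
    exists r => // t' /hr; rewrite -mulrBr nrmM nrm_iC mul1r //.
  move=> t /dP dt e /dt[r r0 hr]; exists r => // t' tt'.
  have := hr (pt x t'); rewrite nrm_ptBy ptBy => /(_ tt').
  by rewrite mulrA [F _ * _]mulrC -!mulrA [F _ * _]mulrC mulrCA.
rewrite !hx // !hy //; ring.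
Qed.

End Contour.

(** * Goursat's theorem *)

Section Goursat.
Context {R : realType}.
Local Notation C := (Cplx R).
Implicit Types (F G Phi : C -> C) (a b c d x y u v s : R) (l w z : C).

(** Compactness of the unit square in the form of an induction principle. If
    [P] failed for the whole square, it would fail for one of the four quarters,
    then for a quarter of it, and so on; the nested squares shrink to a point,
    around which [P] holds for all small squares. *)
Lemma bisection_induction (P : R -> R -> R -> Prop) :
  (forall u v s, 0 < s -> 0 <= u -> u + s <= 1 -> 0 <= v -> v + s <= 1 ->
     P u v (s / 2) -> P (u + s / 2) v (s / 2) -> P u (v + s / 2) (s / 2) ->
     P (u + s / 2) (v + s / 2) (s / 2) -> P u v s) ->
  (forall x y, 0 <= x <= 1 -> 0 <= y <= 1 -> exists2 d, 0 < d &
     forall u v s, 0 < s < d -> u <= x <= u + s -> v <= y <= v + s ->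
       0 <= u -> u + s <= 1 -> 0 <= v -> v + s <= 1 -> P u v s) ->
  P 0 0 1.
Proof.
move=> hsub hloc; apply: contrapT => nP.
pose s (n : nat) : R := (2 ^+ n)^-1.
have s0 n : 0 < s n by rewrite invr_gt0 exprn_gt0.
have sS n : s n.+1 = s n / 2 by rewrite /s exprSr invfM.
pose bad (n : nat) (p : R * R) := [/\ 0 <= p.1, p.1 + s n <= 1, 0 <= p.2,
  p.2 + s n <= 1 & ~ P p.1 p.2 (s n)].
have step (np : nat * (R * R)) : exists q : R * R, bad np.1 np.2 ->
    [/\ bad np.1.+1 q, np.2.1 <= q.1, q.1 + s np.1.+1 <= np.2.1 + s np.1,
      np.2.2 <= q.2 & q.2 + s np.1.+1 <= np.2.2 + s np.1].
  case: np => n [u v] /=.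
  have [[/= u0 u1 v0 v1 nPn]|nb] := pselect (bad n (u, v)); last first.
    by exists (u, v).
  have sn := s0 n.
  (* Otherwise all four quarters would be good. *)
  have [h1|n1] := pselect (P u v (s n / 2)); last first.
    by exists (u, v) => _; rewrite /bad !sS /=; split => //; [split => //|..]; lra.
  have [h2|n2] := pselect (P (u + s n / 2) v (s n / 2)); last first.
    by exists (u + s n / 2, v) => _; rewrite /bad !sS /=; split => //; [split => //|..]; lra.
  have [h3|n3] := pselect (P u (v + s n / 2) (s n / 2)); last first.
    by exists (u, v + s n / 2) => _; rewrite /bad !sS /=; split => //; [split => //|..]; lra.
  have [h4|n4] := pselect (P (u + s n / 2) (v + s n / 2) (s n / 2)); last first.
    by exists (u + s n / 2, v + s n / 2) => _; rewrite /bad !sS /=; split => //; [split => //|..]; lra.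
  by exfalso; apply: nPn; apply: hsub.
have [next hnext] := choice step.
pose q := fix q (n : nat) : R * R := if n is m.+1 then next (m, q m) else (0, 0).
have qbad n : bad n (q n).
  elim: n => [|n ih]; last by have [] := hnext (n, q n) ih.
  by rewrite /bad /s /= expr0 invr1 add0r.
have q1 n k : (q n).1 <= (q (n + k)%N).1 /\ (q (n + k)%N).1 + s (n + k)%N <= (q n).1 + s n.
  elim: k => [|k [ih1 ih2]]; first by rewrite addn0.
  rewrite addnS; have [_ h1 h2 _ _] := hnext ((n + k)%N, q (n + k)%N) (qbad _).
  by split; [exact: le_trans h1|exact: le_trans ih2].
have q2 n k : (q n).2 <= (q (n + k)%N).2 /\ (q (n + k)%N).2 + s (n + k)%N <= (q n).2 + s n.
  elim: k => [|k [ih1 ih2]]; first by rewrite addn0.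
  rewrite addnS; have [_ _ _ h1 h2] := hnext ((n + k)%N, q (n + k)%N) (qbad _).
  by split; [exact: le_trans h1|exact: le_trans ih2].
have nested (r : nat -> R) :
    (forall n k, r n <= r (n + k)%N /\ r (n + k)%N + s (n + k)%N <= r n + s n) ->
    exists x, forall n, r n <= x <= r n + s n.
  move=> hr.
  have ub n : ubound (range r) (r n + s n).
    move=> _ [m _ <-]; have [nm|/ltnW mn] := leqP n m.
      have [_] := hr n (m - n)%N; rewrite subnKC //; have := s0 m; lra.
    have [+ _] := hr m (n - m)%N; rewrite subnKC //; have := s0 n; lra.
  have hs : has_sup (range r).
    by split; [exists (r 0%N); exists 0%N|exists (r 0%N + s 0%N); exact: ub].
  exists (sup (range r)) => n; apply/andP; split.
    by apply: (sup_upper_bound hs); exists n.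
  by apply: ge_sup; [case: hs|exact: ub].
have [x hx] := nested (fun n => (q n).1) q1.
have [y hy] := nested (fun n => (q n).2) q2.
have /= s01 : s 0%N = 1 by rewrite /s expr0 invr1.
have x01 : 0 <= x <= 1 by have := hx 0%N; rewrite /= s01 add0r.
have y01 : 0 <= y <= 1 by have := hy 0%N; rewrite /= s01 add0r.
have [d d0 hd] := hloc x y x01 y01.
have [n hn] : exists n, s n < d.
  have [m hm] : exists m : nat, d^-1 < m%:R.
    by exists (Num.truncn d^-1).+1; exact: truncnS_gt.
  exists m; rewrite /s -[d]invrK ltf_pV2 ?posrE ?invr_gt0 ?exprn_gt0 //.
  by apply: (lt_trans hm); rewrite -natrX ltr_nat ltn_expl.
have [b1 b2 b3 b4] := qbad n; apply.
by apply: hd => //; rewrite s0.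
Qed.

Lemma nrmD4 w1 w2 w3 w4 (M : R) :
  nrm w1 <= M -> nrm w2 <= M -> nrm w3 <= M -> nrm w4 <= M ->
  nrm (w1 + w2 + (w3 + w4)) <= 4 * M.
Proof.
move=> h1 h2 h3 h4; have := nrmD w1 w2; have := nrmD w3 w4.
have := nrmD (w1 + w2) (w3 + w4); lra.
Qed.

Lemma congr_contour F a a' b b' c c' d d' :
  a = a' -> b = b' -> c = c' -> d = d' ->
  contour F a b c d = contour F a' b' c' d'.
Proof. by move=> -> -> -> ->. Qed.

(** The property propagated by bisection is that the integral over the boundary
    of a subrectangle is at most [e] times the square of its scale [s]: it is
    stable under subdivision because the area is additive. It holds at small
    scales because [F] is there an affine function, whose integral is 0, plus a
    remainder [rho] that is [o(s)] on a contour of length [O(s)]. *)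
Lemma goursat F a b c d : a <= b -> c <= d ->
  on_rect (fun w => exists l, cder F w l) a b c d -> contour F a b c d = 0.
Proof.
move=> ab cd dF; apply: nrm_small => e e0.
have cF : on_rect (ccont F) a b c d.
  by apply: on_rect_imp dF => w [l]; exact: cder_cont.
have L0 : 0 <= b - a by lra.
have H0 : 0 <= d - c by lra.
set L := b - a in L0; set H := d - c in H0.
have inx u s t : 0 <= u -> u + s <= 1 -> a + u * L <= t <= a + (u + s) * L ->
    a <= t <= b.
  move=> u0 us /andP[h1 h2].
  have h3 : 0 <= u * L by rewrite mulr_ge0.
  have h4 : (u + s) * L <= L by rewrite ler_piMl.
  by rewrite /L in h1 h2 h3 h4 *; lra.
have iny v s t : 0 <= v -> v + s <= 1 -> c + v * H <= t <= c + (v + s) * H ->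
    c <= t <= d.
  move=> u0 us /andP[h1 h2].
  have h3 : 0 <= v * H by rewrite mulr_ge0.
  have h4 : (v + s) * H <= H by rewrite ler_piMl.
  by rewrite /H in h1 h2 h3 h4 *; lra.
pose Q u v s := contour F (a + u * L) (a + (u + s) * L) (c + v * H) (c + (v + s) * H).
have -> : contour F a b c d = Q 0 0 1.
  by apply: congr_contour; rewrite /L /H; ring.
have -> : e = e * 1 ^+ 2 by rewrite expr1n mulr1.
apply: (bisection_induction (P := fun u v s => nrm (Q u v s) <= e * s ^+ 2)).
  move=> u v s s0 u0 us v0 vs.
  have -> : Q u v s = (Q u v (s / 2) + Q u (v + s / 2) (s / 2)) +
     (Q (u + s / 2) v (s / 2) + Q (u + s / 2) (v + s / 2) (s / 2)).
    have sL : 0 <= s / 2 * L by rewrite mulr_ge0 //; lra.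
    have sH : 0 <= s / 2 * H by rewrite mulr_ge0 //; lra.
    have -> : Q u v s = contour F (a + u * L) (a + (u + (s / 2 + s / 2)) * L)
        (c + v * H) (c + (v + (s / 2 + s / 2)) * H).
      by apply: congr_contour; field.
    rewrite (@contour_splitx _ _ _ (a + (u + s / 2) * L)); first last.
    - move=> x y hx hy; apply: cF; first by apply: (inx u s); lra.
      by apply: (iny v s); lra.
    - lra.
    - lra.
    rewrite (@contour_splity _ _ _ _ _ (c + (v + s / 2) * H)); first last.
    - move=> x y hx hy; apply: cF; first by apply: (inx u s); lra.
      by apply: (iny v s); lra.
    - lra.
    - lra.
    rewrite [X in _ + X](@contour_splity _ _ _ _ _ (c + (v + s / 2) * H)); first last.
    - move=> x y hx hy; apply: cF; first by apply: (inx u s); lra.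
      by apply: (iny v s); lra.
    - lra.
    - lra.
    by congr (_ + _ + (_ + _)); apply: congr_contour; ring.
  move=> h1 h2 h3 h4; have := nrmD4 h1 h3 h2 h4.
  by rewrite (_ : 4 * _ = e * s ^+ 2) //; field.
move=> x y x01 y01.
set px := a + x * L; set py := c + y * H.
have hpx : a <= px <= b by apply: (inx x 0); rewrite ?addr0 ?lexx //; lra.
have hpy : c <= py <= d by apply: (iny y 0); rewrite ?addr0 ?lexx //; lra.
have [l dl] := dF px py hpx hpy.
set p := pt px py in dl.
(* The summand 1 keeps [K] positive for degenerate rectangles. *)
pose K := L + H + 1.
have K0 : 0 < K by rewrite /K; lra.
have e'0 : 0 < e / (4 * K ^+ 2) by rewrite divr_gt0 // mulr_gt0 // exprn_gt0.
have [r r0 hr] := dl _ e'0.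
exists (r / K); first by rewrite divr_gt0.
move=> u v s /andP[s0]; rewrite ltr_pdivlMr // => sr ux vy u0 us v0 vs.
have sL : 0 <= s * L by rewrite mulr_ge0 //; lra.
have sH : 0 <= s * H by rewrite mulr_ge0 //; lra.
have uL : u * L <= x * L <= (u + s) * L.
  by rewrite !ler_wpM2r //; lra.
have vH : v * H <= y * H <= (v + s) * H.
  by rewrite !ler_wpM2r //; lra.
pose A w := F p + l * (w - p).
have dA w : cder A w l.
  have := cderD (cder_cst (F p) w) (cderM (cder_cst l w) (cderB (cder_id w) (cder_cst p w))).
  by rewrite [X in cder _ _ X](_ : _ = l) //; ring.
have cA w : ccont A w by exact: cder_cont (dA w).
pose rho w := F w - A w.
have hu : a + u * L <= a + (u + s) * L by lra.
have hv : c + v * H <= c + (v + s) * H by lra.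
have crho : on_rect (ccont rho) (a + u * L) (a + (u + s) * L) (c + v * H) (c + (v + s) * H).
  move=> x' y' hx hy; apply: ccontB; last exact: cA.
  by apply: cF; [exact: (inx u s)|exact: (iny v s)].
have -> : Q u v s = contour rho (a + u * L) (a + (u + s) * L) (c + v * H) (c + (v + s) * H).
  rewrite /Q -[RHS]addr0.
  have <- : contour A (a + u * L) (a + (u + s) * L) (c + v * H) (c + (v + s) * H) = 0.
    apply: (@contour_primitive _ _ (fun w => F p * w + l / 2 * (w - p) ^+ 2)) => //.
    apply: on_rect_boundary => // x' y' _ _.
    set w := pt _ _.
    have dsq := cderM (cder_cst (l / 2) w) (cderX 1 (cderB (cder_id w) (cder_cst p w))).
    have := cderD (cderM (cder_cst (F p) w) (cder_id w)) dsq.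
    rewrite [X in cder _ _ X -> _](_ : _ = A w) //.
    by rewrite /A; field.
  rewrite -contourD.
  - by apply: eq_contour; apply: on_rect_boundary => // x' y' _ _; rewrite /rho subrK.
  - exact: on_rect_boundary.
  - by apply: on_rect_boundary => // x' y' _ _.
have hb : on_rect (fun w => nrm (rho w) <= e / (4 * K ^+ 2) * (s * K))
    (a + u * L) (a + (u + s) * L) (c + v * H) (c + (v + s) * H).
  move=> x' y' /andP[x1 x2] /andP[y1 y2].
  have hw : nrm (pt x' y' - p) <= s * (L + H).
    have -> : pt x' y' - p = (pt x' y' - pt px y') + (pt px y' - pt px py) by rewrite /p; ring.
    apply: (le_trans (nrmD _ _)); rewrite nrm_ptBx nrm_ptBy.
    rewrite mulrDr lerD // ler_norml /px /py; lra.
  have hw2 : nrm (pt x' y' - p) <= s * K by apply: (le_trans hw); rewrite /K !mulrDr; lra.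
  have h := hr _ (le_lt_trans hw2 sr).
  rewrite (_ : rho _ = F (pt x' y') - F p - l * (pt x' y' - p)); last by rewrite /rho /A; ring.
  by apply: (le_trans h); rewrite ler_pM2l.
have := contour_bound hu hv (on_rect_boundary hu hv crho) (on_rect_boundary hu hv hb).
move=> h; apply: (le_trans h).
have -> : (a + (u + s) * L - (a + u * L) + (c + (v + s) * H - (c + v * H))) = s * (L + H) by ring.
have -> : 4 * (e / (4 * K ^+ 2) * (s * K)) * (s * (L + H)) = e * s ^+ 2 * ((L + H) / K).
  by field; exact: lt0r_neq0.
rewrite ler_piMr //; first by rewrite mulr_ge0 ?exprn_ge0 //; lra.
by rewrite ler_pdivrMr // mul1r /K; lra.
Qed.

(** Four cuts around the exceptional point leave a small square, over which the
    integral tends to 0 with the side since [F] stays bounded. *)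
Lemma goursat_except F a b c d x0 y0 : a < x0 < b -> c < y0 < d ->
  on_rect (ccont F) a b c d ->
  on_rect (fun w => w != pt x0 y0 -> exists l, cder F w l) a b c d ->
  contour F a b c d = 0.
Proof.
move=> hx0 hy0 cF dF; apply: nrm_small => e e0.
have cz : ccont F (pt x0 y0) by apply: cF; lra.
have [r r0 hr] := cz 1 ltr01.
pose M := nrm (F (pt x0 y0)) + 1.
have M0 : 0 < M by rewrite /M; have := nrm_ge0 (F (pt x0 y0)); lra.
pose eta := Num.min (Num.min (Num.min (x0 - a) (b - x0)) (Num.min (y0 - c) (d - y0)))
   (Num.min (r / 4) (e / (16 * M))).
have eta0 : 0 < eta.
  by rewrite !lt_min !divr_gt0 ?mulr_gt0 //; lra.
have : eta <= eta by [].
rewrite {2}/eta !le_min => /andP[/andP[/andP[h1 h2] /andP[h3 h4]] /andP[h5 h6]].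
have neq x y : x != x0 -> pt x y != pt x0 y0.
  by apply: contraNneq => h; rewrite -(rp_pt x y) h rp_pt.
have neqy x y : y != y0 -> pt x y != pt x0 y0.
  by apply: contraNneq => h; rewrite -(ip_pt x y) h ip_pt.
rewrite (@contour_splitx _ _ _ (x0 - eta)) //; [|lra|lra].
rewrite (@goursat F _ (x0 - eta)); [|lra|lra|]; last first.
  move=> x y hx hy; apply: dF; [lra|lra|].
  by apply: neq; rewrite lt_eqF //; lra.
rewrite add0r (@contour_splitx _ _ _ (x0 + eta)); [|lra|lra|]; last first.
  by move=> x y hx hy; apply: cF; lra.
rewrite (@goursat F (x0 + eta)); [|lra|lra|]; last first.
  move=> x y hx hy; apply: dF; [lra|lra|].
  by apply: neq; rewrite gt_eqF //; lra.
rewrite addr0 (@contour_splity _ _ _ _ _ (y0 - eta)); [|lra|lra|]; last first.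
  by move=> x y hx hy; apply: cF; lra.
rewrite (@goursat F _ _ _ (y0 - eta)); [|lra|lra|]; last first.
  move=> x y hx hy; apply: dF; [lra|lra|].
  by apply: neqy; rewrite lt_eqF //; lra.
rewrite add0r (@contour_splity _ _ _ _ _ (y0 + eta)); [|lra|lra|]; last first.
  by move=> x y hx hy; apply: cF; lra.
rewrite (@goursat F _ _ (y0 + eta)); [|lra|lra|]; last first.
  move=> x y hx hy; apply: dF; [lra|lra|].
  by apply: neqy; rewrite gt_eqF //; lra.
rewrite addr0.
have xx : x0 - eta <= x0 + eta by lra.
have yy : y0 - eta <= y0 + eta by lra.
have hb : on_rect (fun w => nrm (F w) <= M) (x0 - eta) (x0 + eta) (y0 - eta) (y0 + eta).
  move=> x y hx hy.
  have hw : nrm (pt x y - pt x0 y0) < r.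
    have -> : pt x y - pt x0 y0 = (pt x y - pt x0 y) + (pt x0 y - pt x0 y0) by ring.
    apply: (le_lt_trans (nrmD _ _)); rewrite nrm_ptBx nrm_ptBy.
    have hx' : `|x - x0| <= eta by rewrite ler_norml; lra.
    have hy' : `|y - y0| <= eta by rewrite ler_norml; lra.
    lra.
  have := hr _ hw; have := nrm_lbB (F (pt x y)) (F (pt x0 y0)); rewrite /M; lra.
have cb : on_rect (ccont F) (x0 - eta) (x0 + eta) (y0 - eta) (y0 + eta).
  by move=> x y hx hy; apply: cF; lra.
apply: (le_trans (contour_bound xx yy (on_rect_boundary xx yy cb) (on_rect_boundary xx yy hb))).
move: h6; rewrite ler_pdivlMr ?mulr_gt0 // => h6.
have -> : 4 * M * (x0 + eta - (x0 - eta) + (y0 + eta - (y0 - eta))) = eta * (16 * M) by ring.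
exact: h6.
Qed.

End Goursat.

(** * The Cauchy formula on a square *)

Section CauchySquare.
Context {R : realType}.
Local Notation C := (Cplx R).
Local Notation mu := (@lebesgue_measure R).
Implicit Types (f F G Phi : C -> C) (l w z : C) (x y M : R).

(** The square with half-side 1/2 lies inside the unit disc, and its boundary
    stays at distance at least 1/2 from 0. *)
Definition square (P : (C -> Prop) -> R -> R -> R -> R -> Prop) (Q : C -> Prop) :=
  P Q (- (1 / 2)) (1 / 2) (- (1 / 2)) (1 / 2).

Definition square_integral F : C := contour F (- (1 / 2)) (1 / 2) (- (1 / 2)) (1 / 2).

Lemma in_square (P : C -> Prop) : (forall w, nrm w < 1 -> P w) -> square on_rect P.
Proof.
move=> h x y hx hy; apply: h.
have x2 : x ^+ 2 <= 1 / 4 by nra.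
have y2 : y ^+ 2 <= 1 / 4 by nra.
have := nrm_sqr (pt x y); rewrite rp_pt ip_pt => h.
rewrite -(@ltr_pXn2r _ 2) ?nnegrE ?nrm_ge0 // expr1n h; lra.
Qed.

(** Everything that is used about the boundary is this location in an annulus. *)
Lemma on_square (P : C -> Prop) : (forall w, 1 / 2 <= nrm w -> nrm w < 1 -> P w) ->
  square on_boundary P.
Proof.
move=> h.
have h0 : (- (1 / 2) : R) <= 1 / 2 by lra.
have /(on_rect_boundary h0 h0)[b1 b2 b3 b4] := in_square (fun w hw => hw).
have n1 w : `|rp w| = 1 / 2 -> 1 / 2 <= nrm w by move=> <-; exact: rp_le.
have n2 w : `|ip w| = 1 / 2 -> 1 / 2 <= nrm w by move=> <-; exact: ip_le.
have e1 : `|- (1 / 2)| = 1 / 2 :> R by rewrite normrN ger0_norm //; lra.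
have e2 : `|1 / 2| = 1 / 2 :> R by rewrite ger0_norm //; lra.
split=> t ht; apply: h; auto; by [apply: n1; rewrite rp_pt|apply: n2; rewrite ip_pt].
Qed.

Lemma square_integralD F G : square on_boundary (ccont F) -> square on_boundary (ccont G) ->
  square_integral (fun w => F w + G w) = square_integral F + square_integral G.
Proof. exact: contourD. Qed.
Lemma square_integralZ l F : square on_boundary (ccont F) ->
  square_integral (fun w => l * F w) = l * square_integral F.
Proof. exact: contourZ. Qed.
Lemma eq_square_integral F G : (forall w, 1 / 2 <= nrm w -> nrm w < 1 -> F w = G w) ->
  square_integral F = square_integral G.
Proof. by move=> h; apply: eq_contour; exact: on_square. Qed.
Lemma square_integral_bound F M : square on_boundary (ccont F) ->
  square on_boundary (fun w => nrm (F w) <= M) -> nrm (square_integral F) <= 8 * M.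
Proof.
move=> cF hM; have h0 : (- (1 / 2) : R) <= 1 / 2 by lra.
have := contour_bound h0 h0 cF hM; rewrite -/(square_integral F); lra.
Qed.

Lemma bounded_on_square F : square on_rect (ccont F) ->
  exists M, square on_rect (fun w => nrm (F w) <= M).
Proof.
move=> cF.
pose P u v s := exists M, on_rect (fun w => nrm (F w) <= M)
  (u - 1 / 2) (u + s - 1 / 2) (v - 1 / 2) (v + s - 1 / 2).
suff [M hM] : P 0 0 1 by exists M => x y hx hy; apply: hM; lra.
apply: bisection_induction.
  move=> u v s s0 _ _ _ _ [M1 h1] [M2 h2] [M3 h3] [M4 h4].
  exists (Num.max (Num.max M1 M2) (Num.max M3 M4)) => x y hx hy.
  rewrite !le_max.
  have [hxs|hxs] := leP x (u + s / 2 - 1 / 2); have [hys|hys] := leP y (v + s / 2 - 1 / 2).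
  - by rewrite h1 //; lra.
  - by rewrite h3 ?orbT //; lra.
  - by rewrite h2 ?orbT //; lra.
  - by rewrite h4 ?orbT //; lra.
move=> x y hx hy.
have hx2 : - (1 / 2) <= x - 1 / 2 <= 1 / 2 by lra.
have hy2 : - (1 / 2) <= y - 1 / 2 <= 1 / 2 by lra.
have [r r0 hr] := cF _ _ hx2 hy2 1 ltr01.
exists (r / 2); first lra.
move=> u v s hs ux vy _ _ _ _.
exists (nrm (F (pt (x - 1 / 2) (y - 1 / 2))) + 1) => x' y' hx' hy'.
set p := pt (x - _) _; set w := pt x' y'.
have wp : nrm (w - p) < r.
  have -> : w - p = (w - pt (x - 1 / 2) y') + (pt (x - 1 / 2) y' - p) by ring.
  apply: (le_lt_trans (nrmD _ _)); rewrite /w /p nrm_ptBx nrm_ptBy.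
  have h1 : `|x' - (x - 1 / 2)| <= s by rewrite ler_norml; lra.
  have h2 : `|y' - (y - 1 / 2)| <= s by rewrite ler_norml; lra.
  lra.
have := hr _ wp; have := nrm_lbB (F w) (F p); lra.
Qed.

Lemma cder_inv_sub z w : w != z -> cder (fun w => (w - z)^-1) w (- (w - z) ^- 2).
Proof.
move=> wz; have := cderV _ (cderB (cder_id w) (cder_cst z w)).
by rewrite subr_eq0 => /(_ wz); rewrite subr0 mulr1.
Qed.

Lemma ccont_inv_sub z w : w != z -> ccont (fun w => (w - z)^-1) w.
Proof. by move=> /cder_inv_sub /cder_cont. Qed.

Lemma ccont_invX n w : w != 0 -> ccont (fun w => w ^- n) w.
Proof.
move=> w0; case: n => [|n].
  rewrite (_ : (fun w => w ^- 0) = fun=> 1); first exact: cder_cont (cder_cst 1 w).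
  by apply/funext => v; rewrite expr0 invr1.
have := cderV _ (cderX n (cder_id w)).
by rewrite expf_neq0 // => /(_ isT) /cder_cont.
Qed.

(** Without the usual factor [1/(2 i pi)]: the normalization is by
    the same integral for [F = 1] and [n = 0] (see [cauchy_taylor]). *)
Definition cauchy_coef F n : C := square_integral (fun w => F w * w ^- n.+1).

Lemma neq0_of_half_le w : 1 / 2 <= nrm w -> w != 0.
Proof. by rewrite -nrm_gt0; lra. Qed.

Lemma neq_of_lt_half_le z w : nrm z < 1 / 2 -> 1 / 2 <= nrm w -> w != z.
Proof. by move=> hz; apply: contraTneq => ->; lra. Qed.

Lemma ccont_kernel F n z w : ccont F w -> w != 0 -> w != z ->
  ccont (fun w => F w * (w ^- n * (w - z)^-1)) w.
Proof.
by move=> cF w0 wz; apply: ccontM => //; apply: ccontM;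
  [exact: ccont_invX|exact: ccont_inv_sub].
Qed.

(** The kernel satisfies [1/(w-z) = sum_(n<N) z^n/w^(n+1) + (z/w)^N/(w-z)]. *)
Lemma kernel_expansion F z N : nrm z < 1 / 2 ->
  (forall w, nrm w < 1 -> ccont F w) ->
  square_integral (fun w => F w * (w - z)^-1) =
  \sum_(n < N) cauchy_coef F n * z ^+ n +
  z ^+ N * square_integral (fun w => F w * (w ^- N * (w - z)^-1)).
Proof.
move=> hz cF; elim: N => [|N ih].
  rewrite big_ord0 add0r mul1r; apply: eq_square_integral => w _ _.
  by rewrite expr0 invr1 mul1r.
rewrite ih big_ord_recr /= -addrA; congr (_ + _).
rewrite exprS [z * _]mulrC -mulrA [cauchy_coef F N * _]mulrC -mulrDr; congr (_ * _).
rewrite -square_integralZ; last first.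
  apply: on_square => w w1 w2; apply: ccont_kernel; first exact: cF.
    exact: neq0_of_half_le.
  exact: neq_of_lt_half_le.
rewrite /cauchy_coef -square_integralD; first last.
- apply: on_square => w w1 w2.
  apply: (@ccontM _ (fun=> z)); first exact: cder_cont (cder_cst _ _).
  apply: ccont_kernel; first exact: cF.
    exact: neq0_of_half_le.
  exact: neq_of_lt_half_le.
- apply: on_square => w w1 w2; apply: ccontM; first exact: cF.
  by apply: ccont_invX; exact: neq0_of_half_le.
apply: eq_square_integral => w w1 w2.
have w0 := neq0_of_half_le w1.
have wz : w - z != 0 by rewrite subr_eq0; exact: neq_of_lt_half_le.
have wN : w ^+ N != 0 by exact: expf_neq0.
rewrite exprS; field.
by rewrite w0 wz wN.
Qed.

(** The remainder decays because [|z/w| <= 2 |z| < 1] on the boundary. *)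
Lemma kernel_series F z M : nrm z < 1 / 2 ->
  (forall w, nrm w < 1 -> ccont F w) -> 
  square on_boundary (fun w => nrm (F w) <= M) -> 
  forall N, nrm (square_integral (fun w => F w * (w - z)^-1) -
    \sum_(n < N) cauchy_coef F n * z ^+ n)
    <= 8 * (M / (1 / 2 - nrm z)) * (2 * nrm z) ^+ N.
Proof.
move=> hz cF hM N; rewrite (kernel_expansion N hz cF) addrAC subrr add0r.
rewrite nrmM nrmX.
have -> : 8 * (M / (1 / 2 - nrm z)) * (2 * nrm z) ^+ N =
  nrm z ^+ N * (8 * (M * (2 ^+ N * (1 / 2 - nrm z)^-1))) by rewrite exprMn; ring.
apply: ler_wpM2l; first by rewrite exprn_ge0 ?nrm_ge0.
apply: square_integral_bound.
  apply: on_square => w w1 w2; apply: ccont_kernel; first exact: cF.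
    exact: neq0_of_half_le.
  exact: neq_of_lt_half_le.
have hw w : 1 / 2 <= nrm w -> nrm (F w) <= M ->
    nrm (F w * (w ^- N * (w - z)^-1)) <= M * (2 ^+ N * (1 / 2 - nrm z)^-1).
  move=> w1 hF; rewrite nrmM; apply: ler_pM; rewrite ?nrm_ge0 //.
  rewrite nrmM; apply: ler_pM; rewrite ?nrm_ge0 //.
    rewrite nrmV nrmX -[2 ^+ N]invrK lef_pV2 ?posrE ?invr_gt0 ?exprn_gt0 //; last lra.
    by rewrite -exprVn lerXn2r ?nnegrE //; lra.
  rewrite nrmV lef_pV2 ?posrE; have := nrm_lbB w z; lra.
have [b1 b2 b3 b4] := on_square (P := fun w => 1 / 2 <= nrm w) (fun w h _ => h).
by case: hM => m1 m2 m3 m4; split=> t ht; apply: hw; auto.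
Qed.

Lemma cauchy_coef_bound F M n : (forall w, nrm w < 1 -> ccont F w) ->
  square on_boundary (fun w => nrm (F w) <= M) ->
  nrm (cauchy_coef F n) <= 8 * (M * 2 ^+ n.+1).
Proof.
move=> cF hM; apply: square_integral_bound.
  apply: on_square => w w1 w2; apply: ccontM; first exact: cF.
  by apply: ccont_invX; exact: neq0_of_half_le.
have hw w : 1 / 2 <= nrm w -> nrm (F w) <= M -> nrm (F w * w ^- n.+1) <= M * 2 ^+ n.+1.
  move=> w1 hF; rewrite nrmM; apply: ler_pM; rewrite ?nrm_ge0 //.
  rewrite nrmV nrmX -[2 ^+ n.+1]invrK lef_pV2 ?posrE ?invr_gt0 ?exprn_gt0 //; last lra.
  by rewrite -exprVn lerXn2r ?nnegrE //; lra.
have [b1 b2 b3 b4] := on_square (P := fun w => 1 / 2 <= nrm w) (fun w h _ => h).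
by case: hM => m1 m2 m3 m4; split=> t ht; apply: hw; auto.
Qed.

(** The powers [w^-(n+2)] have a primitive away from 0. *)
Lemma cauchy_coef1_eq0 n : cauchy_coef (fun=> 1) n.+1 = 0.
Proof.
have h0 : (- (1 / 2) : R) <= 1 / 2 by lra.
apply: (contour_primitive (Phi := fun w => - n.+1%:R^-1 * w ^- n.+1)) => //.
  apply: on_square => w w1 w2; apply: ccontM; first exact: cder_cont (cder_cst _ _).
  by apply: ccont_invX; exact: neq0_of_half_le.
apply: on_square => w w1 w2; have w0 := neq0_of_half_le w1.
have wn : w ^+ n != 0 by exact: expf_neq0.
have := cderV _ (cderX n (cder_id w)); rewrite expf_neq0 // => /(_ isT) dV.
have := cderM (cder_cst (- n.+1%:R^-1) w) dV.
rewrite [X in cder _ _ X -> _](_ : _ = 1 * w ^- n.+2) //.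
have : n.+1%:R != 0 :> C by rewrite pnatr_eq0.
rewrite !exprS; move: (n.+1%:R) => k k0; field.
by rewrite w0 wn k0.
Qed.

Lemma rp_inv w : rp w^-1 = rp w / nrm w ^+ 2.
Proof.
have [->|w0] := eqVneq w 0; first by rewrite invr0 -toC0 rp_toC mul0r.
have n0 : nrm w ^+ 2 != 0 by rewrite expf_eq0 /= nrm_eq0.
have : w^-1 * w = 1 by rewrite mulVf.
move=> h; have := congr1 rp h; have := congr1 ip h.
rewrite rpM ipM -toC1 rp_toC ip_toC.
rewrite nrm_sqr in n0 *; move: n0.
move: (rp w) (ip w) (rp w^-1) (ip w^-1) => a b p q ab h1 h2.
have -> : p = p * (a ^+ 2 + b ^+ 2) / (a ^+ 2 + b ^+ 2) by rewrite mulfK.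
congr (_ / _).
have -> : p * (a ^+ 2 + b ^+ 2) = a * (p * a - q * b) + b * (p * b + q * a) by ring.
by rewrite h1 h2 mulr0 mulr1 addr0.
Qed.

Lemma ip_inv w : ip w^-1 = - ip w / nrm w ^+ 2.
Proof.
have := rp_inv (iC * w); rewrite invfM nrmM nrm_iC mul1r.
have -> : iC^-1 = - iC :> C.
  by apply: (mulIf (_ : iC != 0)); rewrite -?nrm_gt0 ?nrm_iC //
    mulNr iC_sqr mulVf ?opprK // -nrm_gt0 nrm_iC.
by rewrite mulNr rpN !rpM rp_i ip_i !mul0r !mul1r !sub0r opprK.
Qed.

Lemma ip_iCM w : ip (iC * w) = rp w.
Proof. by rewrite ipM rp_i ip_i mul0r mul1r add0r. Qed.

(** The integral of [dw/w] is [2 i pi], but it is enough that each of the four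
    sides contributes at least 1 to its imaginary part. *)
Lemma cauchy_coef1_neq0 : cauchy_coef (fun=> 1) 0 != 0.
Proof.
have hF w : 1 / 2 <= nrm w -> nrm w < 1 -> ccont (fun w => w^-1) w.
  by move=> h1 h2; have := ccont_invX 1 (neq0_of_half_le h1).
have [c1 c2 c3 c4] := on_square hF.
have -> : cauchy_coef (fun=> 1) 0 = square_integral (fun w => w^-1).
  by apply: eq_square_integral => w _ _; rewrite mul1r.
suff : 0 < ip (square_integral (fun w => w^-1))
  by apply: contraTneq => ->; rewrite -toC0 ip_toC ltxx.
have h0 : (- (1 / 2) : R) < 1 / 2 by lra.
have key (s : R) (u : R -> R) : mu.-integrable `[(- (1 / 2)), 1 / 2] (EFin \o u) ->
   (forall t, - (1 / 2) <= t <= 1 / 2 -> 0 <= s * u t - 1) ->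
   1 <= s * (\int[mu]_(t in `[(- (1 / 2)), (1 / 2)%R]) u t)%R.
  move=> iu hu; rewrite -RintegralZl //.
  rewrite [leLHS](_ : 1 = (\int[mu]_(t in `[(- (1 / 2)), (1 / 2)%R]) (cst 1 t))%R); last first.
    rewrite Rintegral_cst //= lebesgue_measure_itv /= lte_fin h0 /=; by field.
  apply: le_Rintegral => //.
  - apply: continuous_compact_integrable; first exact: segment_compact.
    by move=> t; exact: cvg_cst.
  - by have := integrableZl _ s iu; apply.
  - by move=> t /=; rewrite in_itv /= => /hu; lra.
have est (b : R) : - (1 / 2) <= b <= 1 / 2 -> 0 <= 1 / 2 / ((1 / 2) ^+ 2 + b ^+ 2) - 1.
  move=> hb; have b2 : b ^+ 2 <= 1 / 4 by nra.
  have b3 := sqr_ge0 b.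
  by rewrite subr_ge0 ler_pdivlMr; lra.
have k1 := key 1 _ (integrable_ip (edge_contx c1)).
have k2 := key (-1) _ (integrable_ip (edge_contx c2)).
have k3 := key (-1) _ (integrable_rp (edge_conty c3)).
have k4 := key 1 _ (integrable_rp (edge_conty c4)).
rewrite /square_integral /contour !ipB ipD !ip_iCM !ip_path_int !rp_path_int.
have fin (s x t : R) : s * x = 1 / 2 -> - (1 / 2) <= t <= 1 / 2 ->
    forall n, n = (1 / 2) ^+ 2 + t ^+ 2 -> 0 <= s * (x / n) - 1.
  by move=> sx ht n ->; rewrite mulrA sx; exact: est.
have h1 (t : R) : - (1 / 2) <= t <= 1 / 2 -> 0 <= 1 * ip (pt t (- (1 / 2)))^-1 - 1.
  by move=> ht; rewrite ip_inv nrm_sqr rp_pt ip_pt; apply: (fin _ _ t) => //; by field.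
have h2 (t : R) : - (1 / 2) <= t <= 1 / 2 -> 0 <= -1 * ip (pt t (1 / 2))^-1 - 1.
  by move=> ht; rewrite ip_inv nrm_sqr rp_pt ip_pt; apply: (fin _ _ t) => //; by field.
have h3 (t : R) : - (1 / 2) <= t <= 1 / 2 -> 0 <= -1 * rp (pt (- (1 / 2)) t)^-1 - 1.
  by move=> ht; rewrite rp_inv nrm_sqr rp_pt ip_pt; apply: (fin _ _ t) => //; by field.
have h4 (t : R) : - (1 / 2) <= t <= 1 / 2 -> 0 <= 1 * rp (pt (1 / 2) t)^-1 - 1.
  by move=> ht; rewrite rp_inv nrm_sqr rp_pt ip_pt; apply: (fin _ _ t) => //; by field.
move: (k1 h1) (k2 h2) (k3 h3) (k4 h4).
move: (\int[_]_(_ in _) _) (\int[_]_(_ in _) _) (\int[_]_(_ in _) _) (\int[_]_(_ in _) _).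
by move=> a b c d; lra.
Qed.

Definition has_pseries (c : nat -> C) f (r : R) := forall z, nrm z < r ->
  forall e, 0 < e -> exists N, forall n, (N <= n)%N ->
    nrm (f z - \sum_(k < n) c k * z ^+ k) <= e.

Lemma geometric_small (q e : R) : 0 <= q < 1 -> 0 < e ->
  exists N, forall n, (N <= n)%N -> q ^+ n <= e.
Proof.
move=> /andP[q0 q1] e0.
have := @cvg_expr R q; rewrite ger0_norm // => /(_ q1).
move=> /cvgrPdist_le /(_ e e0) [N _ hN]; exists N => n Nn.
by have := hN n Nn; rewrite sub0r normrN ger0_norm // exprn_ge0.
Qed.

Lemma kernel_cvg F z : nrm z < 1 / 2 ->
  (forall w, nrm w < 1 -> ccont F w) -> forall e, 0 < e ->
  exists N, forall n, (N <= n)%N ->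
    nrm (square_integral (fun w => F w * (w - z)^-1) -
      \sum_(k < n) cauchy_coef F k * z ^+ k) <= e.
Proof.
move=> hz cF e e0.
have [M hM] := bounded_on_square (in_square cF).
have h0 : (- (1 / 2) : R) <= 1 / 2 by lra.
have hM' := on_rect_boundary h0 h0 hM.
have M0 : 0 <= M.
  by apply: (le_trans (nrm_ge0 (F (pt 0 0)))); apply: hM; lra.
pose K := 8 * (M / (1 / 2 - nrm z)) + 1.
have K0 : 0 < K.
  have : 0 <= M / (1 / 2 - nrm z) by rewrite divr_ge0 //; lra.
  rewrite /K; lra.
have [|N hN] := @geometric_small (2 * nrm z) (e / K) _ (divr_gt0 e0 K0).
  have := nrm_ge0 z; lra.
exists N => n /hN; rewrite ler_pdivlMr // => hn.
apply: (le_trans (kernel_series hz cF hM' n)).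
apply: le_trans hn; rewrite mulrC ler_wpM2l ?exprn_ge0 ?mulr_ge0 ?nrm_ge0 //.
rewrite /K; lra.
Qed.

Lemma sum_cauchy_coef1 z n :
  \sum_(k < n.+1) cauchy_coef (fun=> 1) k * z ^+ k = cauchy_coef (fun=> 1) 0.
Proof.
rewrite big_ord_recl mulr1 big1 ?addr0 // => k _.
by rewrite /= cauchy_coef1_eq0 mul0r.
Qed.

(** The expansion of the kernel applied to the constant function 1, for which
    all terms but the first vanish. *)
Lemma square_integral_kernel z : nrm z < 1 / 2 ->
  square_integral (fun w => (w - z)^-1) = cauchy_coef (fun=> 1) 0.
Proof.
move=> hz; apply/eqP; rewrite -subr_eq0; apply/eqP/nrm_small => e e0.
have [|N hN] := @kernel_cvg (fun=> 1) z hz _ e e0.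
  by move=> w _; exact: cder_cont (cder_cst _ _).
have := hN N.+1 (leqnSn _); rewrite sum_cauchy_coef1.
by rewrite (_ : square_integral _ = square_integral (fun w => (w - z)^-1)) //;
  apply: eq_square_integral => w _ _; rewrite mul1r.
Qed.

(** The difference quotient [G] of [F] at [z] is continuous at [z] and
    differentiable elsewhere, so that [goursat_except] applies to it. *)
Lemma cauchy_formula F z : nrm z < 1 / 2 ->
  (forall w, nrm w < 1 -> exists l, cder F w l) ->
  square_integral (fun w => F w * (w - z)^-1) = F z * cauchy_coef (fun=> 1) 0.
Proof.
move=> hz dF.
have cF w : nrm w < 1 -> ccont F w by move=> /dF[l]; exact: cder_cont.
have [l dl] : exists l, cder F z l by apply: dF; lra.
pose G w := if w == z then l else (F w - F z) * (w - z)^-1.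
have Gne w : w != z -> G w = (F w - F z) * (w - z)^-1 by rewrite /G => /negPf ->.
have nearG w : w != z -> exists2 d : R, 0 < d & forall v, nrm (v - w) < d ->
    (F v - F z) * (v - z)^-1 = G v.
  move=> wz; exists (nrm (w - z)); first by rewrite nrm_gt0 subr_eq0.
  move=> v vw; rewrite Gne //; apply: contraTneq vw => ->.
  by rewrite nrmC ltxx.
have dG w : nrm w < 1 -> w != z -> exists m, cder G w m.
  move=> w1 wz; have [m dm] := dF w w1.
  eexists; apply: (eq_near_cder (nearG w wz)).
  apply: cderM; last exact: cder_inv_sub.
  exact: (cderB dm (cder_cst (F z) w)).
have cG w : nrm w < 1 -> ccont G w.
  move=> w1; have [->|wz] := eqVneq w z; last first.
    by have [m] := dG w w1 wz; exact: cder_cont.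
  move=> e e0; have [d d0 hd] := dl e e0; exists d => // v vz.
  have [->|vnz] := eqVneq v z; first by rewrite subrr nrm0 ltW.
  rewrite Gne // /G eqxx.
  have v0 : v - z != 0 by rewrite subr_eq0.
  have -> : (F v - F z) * (v - z)^-1 - l = (v - z)^-1 * (F v - F z - l * (v - z)).
    by field.
  by rewrite nrmM nrmV mulrC ler_pdivrMr ?nrm_gt0 //; exact: hd.
have rpz : - (1 / 2) < rp z < 1 / 2 by rewrite -ltr_norml (le_lt_trans (rp_le z)).
have ipz : - (1 / 2) < ip z < 1 / 2 by rewrite -ltr_norml (le_lt_trans (ip_le z)).
have : square_integral G = 0.
  apply: (goursat_except rpz ipz); first exact: in_square.
  by rewrite pt_rpip; exact: in_square.
have -> : square_integral G = square_integral (fun w => F w * (w - z)^-1 + - F z * (w - z)^-1).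
  apply: eq_square_integral => w w1 w2; rewrite Gne; last exact: neq_of_lt_half_le.
  by rewrite mulrBl mulNr.
have hk : square on_boundary (ccont (fun w => (w - z)^-1)).
  by apply: on_square => w w1 w2; apply: ccont_inv_sub; exact: neq_of_lt_half_le.
rewrite square_integralD; first last.
- apply: on_square => w w1 w2.
  apply: (@ccontM _ (fun=> - F z)); first exact: cder_cont (cder_cst _ _).
  by apply: ccont_inv_sub; exact: neq_of_lt_half_le.
- apply: on_square => w w1 w2; apply: ccontM; first exact: cF.
  by apply: ccont_inv_sub; exact: neq_of_lt_half_le.
rewrite square_integralZ // square_integral_kernel // mulNr => /eqP; rewrite subr_eq0 => /eqP ->.
by [].
Qed.

Definition cauchy_taylor F n : C := cauchy_coef F n / cauchy_coef (fun=> 1) 0.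

Lemma cauchy_series F : (forall w, nrm w < 1 -> exists l, cder F w l) ->
  has_pseries (cauchy_taylor F) F (1 / 2).
Proof.
move=> dF z hz e e0.
set k := cauchy_coef (fun=> 1) 0; have k0 : k != 0 by exact: cauchy_coef1_neq0.
have nk : 0 < nrm k by rewrite nrm_gt0.
have cF w : nrm w < 1 -> ccont F w by move=> /dF[l]; exact: cder_cont.
have [N hN] := kernel_cvg hz cF (mulr_gt0 e0 nk).
exists N => n /hN; rewrite cauchy_formula // -/k => h.
have -> : F z - \sum_(i < n) cauchy_taylor F i * z ^+ i =
    (F z * k - \sum_(i < n) cauchy_coef F i * z ^+ i) / k.
  rewrite mulrBl mulfK // mulr_suml; congr (_ - _); apply: eq_bigr => i _.
  by rewrite /cauchy_taylor mulrAC.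
by rewrite nrmM nrmV ler_pdivrMr.
Qed.

(** The factor [8 * 2^(n+1)] combines the bound 8 for integrals over the
    boundary with [|w| >= 1/2] there. *)
Definition cauchy_const n : R := 8 * 2 ^+ n.+1 / nrm (cauchy_coef (fun=> 1) 0).

Lemma cauchy_const_gt0 n : 0 < cauchy_const n.
Proof.
by rewrite divr_gt0 ?nrm_gt0 ?cauchy_coef1_neq0 // mulr_gt0 // exprn_gt0.
Qed.

Lemma cauchy_taylor_bound F M n : (forall w, nrm w < 1 -> exists l, cder F w l) ->
  (forall w, nrm w < 1 -> nrm (F w) <= M) ->
  nrm (cauchy_taylor F n) <= M * cauchy_const n.
Proof.
move=> dF hM.
have cF w : nrm w < 1 -> ccont F w by move=> /dF[l]; exact: cder_cont.
have := cauchy_coef_bound n cF (on_square (fun w _ h => hM w h)).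
have k0 : 0 < nrm (cauchy_coef (fun=> 1) 0) by rewrite nrm_gt0 cauchy_coef1_neq0.
move=> h; rewrite /cauchy_taylor /cauchy_const nrmM nrmV [M * _]mulrA.
by apply: ler_wpM2r; [rewrite invr_ge0 ltW|rewrite mulrCA].
Qed.

End CauchySquare.

(** * Power series *)

Section PowerSeries.
Context {R : realType}.
Local Notation C := (Cplx R).
Implicit Types (f : C -> C) (c : nat -> C) (z w : C) (r e : R).

(** By Abel's lemma this says that the radius of convergence is at least [r];
    unlike absolute convergence it is read off directly from coefficient
    bounds, and it passes to the derived series. *)
Definition radius_ge c r := forall rho : R, 0 < rho < r ->
  exists K : R, forall n, nrm (c n) * rho ^+ n <= K.

Definition deriv_coef c : nat -> C := fun n => n.+1%:R * c n.+1.

Definition is_sum (u : nat -> C) s := forall e, 0 < e ->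
  exists N, forall n, (N <= n)%N -> nrm (s - \sum_(k < n) u k) <= e.

(** From [n (1 - q) q^n <= q (1 - q^n)], the comparison of [q + ... + q^n] with
    [n] times its last term. *)
Lemma nat_geometric_bound (q : R) n : 0 < q < 1 -> n%:R * q ^+ n <= q / (1 - q).
Proof.
move=> /andP[q0 q1].
have d0 : 0 < 1 - q by lra.
rewrite ler_pdivlMr //.
have qn k : k%:R * (1 - q) * q ^+ k <= q * (1 - q ^+ k).
  elim: k => [|k ih]; first by rewrite !mul0r expr0 subrr mulr0.
  have qk : 0 <= q ^+ k by rewrite exprn_ge0 // ltW.
  have qk1 : q ^+ k <= 1 by rewrite exprn_ile1 // ltW.
  rewrite -natr1 exprS.
  have h : q * (k%:R * (1 - q) * q ^+ k) <= q * (q * (1 - q ^+ k)) by rewrite ler_pM2l.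
  have -> : (k%:R + 1) * (1 - q) * (q * q ^+ k) =
    q * (k%:R * (1 - q) * q ^+ k) + q * (1 - q) * q ^+ k by ring.
  have : q * (1 - q) * q ^+ k <= q * (1 - q) by rewrite ler_piMr // mulr_ge0 // ltW.
  have -> : q * (1 - q * q ^+ k) = q * (q * (1 - q ^+ k)) + q * (1 - q) by ring.
  lra.
have qk : 0 <= q ^+ n by rewrite exprn_ge0 // ltW.
rewrite mulrAC; apply: (le_trans (qn n)).
by rewrite ler_piMr ?lerBlDr ?lerDl ?(ltW q0).
Qed.

(** The factor [n + 1] is absorbed by an intermediate radius [rho']. *)
Lemma radius_ge_deriv c r : radius_ge c r -> radius_ge (deriv_coef c) r.
Proof.
move=> hc rho /andP[rho0 rhor].
pose rho' := (rho + r) / 2.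
have r'0 : 0 < rho' by rewrite /rho'; lra.
have [|K hK] := hc rho'; first by rewrite /rho'; lra.
pose q := rho / rho'.
have q01 : 0 < q < 1.
  by rewrite /q divr_gt0 //= ltr_pdivrMr // mul1r /rho'; lra.
have K0 : 0 <= K by apply: le_trans (hK 0%N); rewrite mulr_ge0 ?nrm_ge0 ?exprn_ge0 // ltW.
exists (K / rho * (q / (1 - q))) => n.
have hn := nat_geometric_bound n.+1 q01.
have -> : nrm (deriv_coef c n) * rho ^+ n =
    (nrm (c n.+1) * rho' ^+ n.+1) / rho * (n.+1%:R * q ^+ n.+1).
  rewrite nrmM nrm_nat /q; move: rho' r'0 {hK q q01 hn} => x x0.
  rewrite expr_div_n [x ^+ _]exprS [rho ^+ n.+1]exprS.
  have e1 : x ^+ n != 0 by rewrite expf_neq0 // gt_eqF.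
  have e2 : x != 0 by rewrite gt_eqF.
  have e3 : rho != 0 by rewrite gt_eqF.
  by move: (n.+1%:R) => m; field; rewrite e1 e2 e3.
apply: ler_pM => //.
- by rewrite !mulr_ge0 ?nrm_ge0 ?exprn_ge0 ?invr_ge0 ?ltW.
- by rewrite mulr_ge0 // exprn_ge0 // ltW //; case/andP: q01.
- by rewrite ler_pM2r ?invr_gt0.
Qed.

Lemma geometric_sum_bound (q : R) n : 0 <= q < 1 -> \sum_(k < n) q ^+ k <= (1 - q)^-1.
Proof.
move=> /andP[q0 q1].
have d0 : 0 < 1 - q by lra.
rewrite -[leRHS]mul1r ler_pdivlMr // mulrC -opprB mulNr -subrX1 opprB.
by rewrite gerBl exprn_ge0.
Qed.

Lemma is_sum_exists (u : nat -> C) (K q : R) : 0 <= q < 1 ->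
  (forall n, nrm (u n) <= K * q ^+ n) -> exists s, is_sum u s.
Proof.
move=> /andP[q0 q1] hu.
have K0 : 0 <= K by have := hu 0%N; rewrite expr0 mulr1; apply: le_trans; exact: nrm_ge0.
have key (v : nat -> R) : (forall n, `|v n| <= nrm (u n)) ->
    exists s : R, forall e, 0 < e -> exists N, forall n, (N <= n)%N ->
      `|s - \sum_(k < n) v k| <= e.
  move=> hv.
  have cv : cvgn (series v).
    apply: normed_cvg; apply: (@series_le_cvg _ _ (geometric K q)) => //.
    - by move=> n /=.
    - by move=> n; rewrite /geometric /= mulr_ge0 // exprn_ge0.
    - by move=> n; exact: le_trans (hv n) (hu n).
    - by apply: is_cvg_geometric_series; rewrite ger0_norm.
  exists (limn (series v)) => e e0.
  move: cv => /cvgrPdist_le /(_ e e0) [N _ hN]; exists N => n /hN.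
  by rewrite /series /= big_mkord.
have [s hs] := key (fun n => rp (u n)) (fun n => rp_le _).
have [t ht] := key (fun n => ip (u n)) (fun n => ip_le _).
exists (pt s t) => e e0.
have e20 : 0 < e / 2 by lra.
have [N1 h1] := hs _ e20; have [N2 h2] := ht _ e20.
exists (maxn N1 N2) => n; rewrite geq_max => /andP[/h1 n1 /h2 n2].
have rps : rp (\sum_(k < n) u k) = \sum_(k < n) rp (u k).
  by apply: (big_morph rp) => [x y|]; rewrite ?rpD // -toC0 rp_toC.
have ips : ip (\sum_(k < n) u k) = \sum_(k < n) ip (u k).
  by apply: (big_morph ip) => [x y|]; rewrite ?ipD // -toC0 ip_toC.
apply: (le_trans (nrm_le_ri _)).
rewrite rpB ipB rps ips rp_pt ip_pt; lra.
Qed.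

Lemma pseries_sum c r z : radius_ge c r -> nrm z < r ->
  exists s, is_sum (fun k => c k * z ^+ k) s.
Proof.
move=> hc hz; have z0 := nrm_ge0 z.
pose rho := (nrm z + r) / 2.
have r0 : 0 < rho by rewrite /rho; lra.
have [|K hK] := hc rho; first by rewrite /rho; lra.
apply: (@is_sum_exists _ K (nrm z / rho)).
  by rewrite divr_ge0 //=; [rewrite ltr_pdivrMr // mul1r /rho; lra|lra].
move=> n; rewrite nrmM nrmX expr_div_n mulrA ler_pdivlMr ?exprn_gt0 //.
by rewrite mulrAC ler_wpM2r // exprn_ge0.
Qed.

(** The remainders satisfy [E_(n+1) = w E_n + n z^(n-1) (w - z)^2]. *)
Lemma binomial_remainder z w (rho : R) n : nrm z <= rho -> nrm w <= rho ->
  nrm (w ^+ n.+2 - z ^+ n.+2 - n.+2%:R * z ^+ n.+1 * (w - z)) <=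
  n.+2%:R * n.+1%:R * rho ^+ n * nrm (w - z) ^+ 2.
Proof.
move=> hz hw.
have rho0 : 0 <= rho by exact: le_trans (nrm_ge0 z) hz.
elim: n => [|n ih].
  have -> : w ^+ 2 - z ^+ 2 - 2%:R * z ^+ 1 * (w - z) = (w - z) ^+ 2 by ring.
  by rewrite nrmX expr0 !mulr1; have := sqr_ge0 (nrm (w - z)); lra.
have -> : w ^+ n.+3 - z ^+ n.+3 - n.+3%:R * z ^+ n.+2 * (w - z) =
  w * (w ^+ n.+2 - z ^+ n.+2 - n.+2%:R * z ^+ n.+1 * (w - z))
   + n.+2%:R * z ^+ n.+1 * (w - z) ^+ 2.
  by rewrite -[n.+3%:R]natr1 !(exprS _ n.+2) [z ^+ n.+2]exprS; ring.
apply: (le_trans (nrmD _ _)).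
have h1 : nrm (w * (w ^+ n.+2 - z ^+ n.+2 - n.+2%:R * z ^+ n.+1 * (w - z))) <=
   rho * (n.+2%:R * n.+1%:R * rho ^+ n * nrm (w - z) ^+ 2).
  by rewrite nrmM; apply: ler_pM; rewrite ?nrm_ge0.
have h2 : nrm (n.+2%:R * z ^+ n.+1 * (w - z) ^+ 2) <=
   n.+2%:R * rho ^+ n.+1 * nrm (w - z) ^+ 2.
  rewrite (nrmM _ (_ ^+ 2)) (nrmM n.+2%:R) nrm_nat !nrmX; apply: ler_wpM2r.
    by rewrite exprn_ge0 ?nrm_ge0.
  by apply: ler_wpM2l => //; rewrite lerXn2r ?nnegrE ?nrm_ge0.
apply: (le_trans (lerD h1 h2)).
rewrite (_ : _ + _ = n.+2%:R * n.+2%:R * rho ^+ n.+1 * nrm (w - z) ^+ 2); last first.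
  by rewrite (exprS rho n) -(natr1 n.+1); ring.
do 2 (apply: ler_wpM2r; first by rewrite exprn_ge0 ?nrm_ge0).
by apply: ler_wpM2r => //; rewrite ler_nat.
Qed.

Lemma le_of_le_addM (x y k : R) : 0 <= k -> (forall e, 0 < e -> x <= y + e * k) -> x <= y.
Proof.
move=> k0 h; rewrite leNgt; apply/negP => yx.
have k1 : 0 < k + 1 by lra.
have d0 : 0 < x - y by lra.
have e0 : 0 < (x - y) / (k + 1) / 2 by rewrite divr_gt0 // divr_gt0.
have := h _ e0.
have : (x - y) / (k + 1) / 2 * (k + 1) = (x - y) / 2 by field; rewrite gt_eqF.
have : (x - y) / (k + 1) / 2 * k <= (x - y) / (k + 1) / 2 * (k + 1).
  by rewrite ler_pM2l //; lra.
lra.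
Qed.

(** For partial sums the error [S_N(w) - S_N(z) - S_N'(z) (w - z)] is at most
    [|w - z|^2] times a partial sum of the second derived series at the radius
    [rho], which is bounded independently of [N]; so the estimate passes to the
    limit. *)
Lemma pseries_cder c f r z s : radius_ge c r -> has_pseries c f r -> nrm z < r ->
  is_sum (fun k => deriv_coef c k * z ^+ k) s -> cder f z s.
Proof.
move=> hc hf hz hs; have z0 := nrm_ge0 z.
pose rho := (nrm z + r) / 2.
pose rho' := (rho + r) / 2.
have rr : [/\ nrm z < rho, 0 < rho, rho < rho', 0 < rho' & rho' < r].
  by rewrite /rho' /rho; split; lra.
clearbody rho' rho; case: rr => rz r0 rr' r'0 r'r.
have [|K hK] := radius_ge_deriv (radius_ge_deriv hc) (rho := rho'); first by rewrite r'0.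
have q01 : 0 <= rho / rho' < 1.
  by rewrite divr_ge0 ?ltW //= ltr_pdivrMr // mul1r.
have K0 : 0 <= K by apply: le_trans (hK 0%N); rewrite mulr_ge0 ?nrm_ge0 ?exprn_ge0 // ltW.
pose B := K * (1 - rho / rho')^-1.
have B0 : 0 <= B by rewrite mulr_ge0 // invr_ge0; case/andP: q01; lra.
have hB N : \sum_(k < N) nrm (deriv_coef (deriv_coef c) k) * rho ^+ k <= B.
  apply: (@le_trans _ _ (\sum_(k < N) K * (rho / rho') ^+ k)).
    apply: ler_sum => k _; rewrite expr_div_n mulrA ler_pdivlMr ?exprn_gt0 //.
    by rewrite mulrAC ler_wpM2r // exprn_ge0 // ltW.
  by rewrite -mulr_sumr ler_wpM2l // geometric_sum_bound.
have quad w : nrm (w - z) < rho - nrm z ->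
    nrm (f w - f z - s * (w - z)) <= B * nrm (w - z) ^+ 2.
  move=> wz.
  have hw : nrm w <= rho.
    by have := nrmD (w - z) z; rewrite subrK; lra.
  apply: (@le_of_le_addM _ _ (1 + 1 + nrm (w - z))); first by have := nrm_ge0 (w - z); lra.
  move=> e e0.
  have [N1 h1] := hf w (le_lt_trans hw (lt_trans rr' r'r)) e e0.
  have [N2 h2] := hf z hz e e0.
  have [N3 h3] := hs e e0.
  pose N := maxn N1 (maxn N2 N3).
  have n1 : (N1 <= N.+2)%N by do 2 apply: leqW; rewrite leq_maxl.
  have n2 : (N2 <= N.+2)%N by do 2 apply: leqW; rewrite /N leq_max leq_maxl orbT.
  have n3 : (N3 <= N.+1)%N by apply: leqW; rewrite /N !leq_max leqnn !orbT.
  have {n1}h1 := h1 _ n1; have {n2}h2 := h2 _ n2; have {n3}h3 := h3 _ n3.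
  set S1 := \sum_(k < _) _ in h1; set S2 := \sum_(k < _) _ in h2.
  set S3 := \sum_(k < _) _ in h3.
  have main : nrm (S1 - S2 - S3 * (w - z)) <= B * nrm (w - z) ^+ 2.
    have -> : S1 - S2 - S3 * (w - z) = \sum_(k < N)
        c k.+2 * (w ^+ k.+2 - z ^+ k.+2 - k.+2%:R * z ^+ k.+1 * (w - z)).
      rewrite /S1 /S2 /S3 !big_ord_recl /= !expr0 !expr1 !mulr1.
      rewrite (_ : deriv_coef c 0 = c 1%N); last by rewrite /deriv_coef mul1r.
      rewrite [(c 1%N + _) * _]mulrDl mulr_suml.
      rewrite [RHS](eq_bigr (fun k : 'I_N => c k.+2 * w ^+ k.+2 - c k.+2 * z ^+ k.+2
        - deriv_coef c k.+1 * z ^+ k.+1 * (w - z))); last first.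
        by move=> k _; rewrite /deriv_coef; ring.
      rewrite !sumrB /bump /=; ring.
    apply: (le_trans (nrm_sum _ _ _)).
    rewrite mulrC; apply: (@le_trans _ _ (nrm (w - z) ^+ 2 *
      \sum_(k < N) nrm (deriv_coef (deriv_coef c) k) * rho ^+ k)); last first.
      by rewrite ler_wpM2l ?exprn_ge0 ?nrm_ge0.
    rewrite mulr_sumr; apply: ler_sum => k _.
    rewrite /deriv_coef !nrmM !nrm_nat.
    have := binomial_remainder k (ltW rz) hw => h.
    apply: (le_trans (ler_wpM2l (nrm_ge0 _) h)).
    by rewrite le_eqVlt; apply/orP; left; apply/eqP; ring.
  have -> : f w - f z - s * (w - z) =
    (S1 - S2 - S3 * (w - z)) + (f w - S1) - (f z - S2) - (s - S3) * (w - z) by ring.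
  have t1 := nrmB ((S1 - S2 - S3 * (w - z)) + (f w - S1) - (f z - S2)) ((s - S3) * (w - z)).
  have t2 := nrmB ((S1 - S2 - S3 * (w - z)) + (f w - S1)) (f z - S2).
  have t3 := nrmD (S1 - S2 - S3 * (w - z)) (f w - S1).
  have t4 : nrm ((s - S3) * (w - z)) <= e * nrm (w - z).
    by rewrite nrmM ler_wpM2r ?nrm_ge0.
  have -> : e * (1 + 1 + nrm (w - z)) = e + e + e * nrm (w - z) by ring.
  lra.
move=> e e0.
exists (Num.min (rho - nrm z) (e / (B + 1))).
  by rewrite lt_min divr_gt0 ?subr_gt0 //; lra.
move=> w; rewrite lt_min ltr_pdivlMr; last lra.
move=> /andP[/quad wq we]; apply: (le_trans wq).
rewrite expr2 mulrA ler_wpM2r ?nrm_ge0 // mulrC.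
apply: le_trans (ltW we); rewrite ler_wpM2l ?nrm_ge0 //; lra.
Qed.

Lemma pseries_derive1 c f r : radius_ge c r -> has_pseries c f r ->
  has_pseries (deriv_coef c) (derive1 f) r.
Proof.
move=> hc hf z hz.
have [s hs] := pseries_sum (radius_ge_deriv hc) hz.
by have [_ ->] := cder_derivable (pseries_cder hc hf hz hs).
Qed.

Lemma pseries_at0 c f r : 0 < r -> has_pseries c f r -> f 0 = c 0%N.
Proof.
move=> r0 hf; apply/eqP; rewrite -subr_eq0; apply/eqP/nrm_small => e e0.
have [|N hN] := hf 0 _ e e0; first by rewrite nrm0.
have := hN N.+1 (leqnSn _); rewrite big_ord_recl expr0 mulr1 big1 ?addr0 //.
by move=> k _; rewrite /= expr0n mulr0.
Qed.

Lemma pseries_derive1n c f r n : 0 < r -> radius_ge c r -> has_pseries c f r ->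
  derive1n n f 0 = n`!%:R * c n.
Proof.
move=> r0; elim: n c f => [|n ih] c f hc hf.
  by rewrite mul1r; exact: pseries_at0 hf.
rewrite /derive1n iterSr -/(derive1n n _) (ih (deriv_coef c)).
- by rewrite /deriv_coef factS natrM; ring.
- exact: radius_ge_deriv.
- exact: pseries_derive1.
Qed.

Lemma taylor_coef_pseries c f r n : 0 < r -> radius_ge c r -> has_pseries c f r ->
  taylor_coef f n = c n.
Proof.
move=> r0 hc hf; rewrite /taylor_coef (pseries_derive1n n r0 hc hf).
by rewrite mulrC mulKf // pnatr_eq0 -lt0n fact_gt0.
Qed.

Lemma radius_cauchy_taylor f : (forall w, nrm w < 1 -> exists l, cder f w l) ->
  radius_ge (cauchy_taylor f) (1 / 2).
Proof.
move=> df rho /andP[r0 r1].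
have cf w : nrm w < 1 -> ccont f w by move=> /df[l]; exact: cder_cont.
have [M hM] := bounded_on_square (in_square cf).
have h0 : (- (1 / 2) : R) <= 1 / 2 by lra.
have hM' := on_rect_boundary h0 h0 hM.
pose k : C := cauchy_coef (fun=> 1) 0; have k0 : 0 < nrm k by rewrite nrm_gt0 cauchy_coef1_neq0.
have M0 : 0 <= M.
  by apply: (le_trans (nrm_ge0 (f (pt 0 0)))); apply: hM; lra.
exists (16 * M / nrm k) => n.
rewrite /cauchy_taylor nrmM nrmV -/k mulrAC ler_pM2r ?invr_gt0 //.
have := cauchy_coef_bound n cf hM' => h.
apply: (@le_trans _ _ (8 * (M * 2 ^+ n.+1) * rho ^+ n)).
  by rewrite ler_wpM2r // exprn_ge0 // ltW.
have -> : 8 * (M * 2 ^+ n.+1) * rho ^+ n = 16 * M * (2 * rho) ^+ n.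
  by rewrite exprMn exprS; ring.
by rewrite ler_piMr ?mulr_ge0 // exprn_ile1 //; lra.
Qed.

Lemma taylor_coef_cauchy f n : (forall w, nrm w < 1 -> exists l, cder f w l) ->
  taylor_coef f n = cauchy_taylor f n.
Proof.
move=> df; apply: (@taylor_coef_pseries _ _ (1 / 2)); first by lra.
  exact: radius_cauchy_taylor.
exact: cauchy_series.
Qed.

End PowerSeries.

(** * A Rudin-Shapiro series in the disc algebra *)

Section RudinShapiro.
Context {R : realType}.
Local Notation C := (Cplx R).
Implicit Types (z w : C) (r e : R).

Lemma parallelogram z w :
  nrm (z + w) ^+ 2 + nrm (z - w) ^+ 2 = 2 * (nrm z ^+ 2 + nrm w ^+ 2).
Proof. by rewrite !nrm_sqr rpD rpB ipD ipB; ring. Qed.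

Fixpoint rudin_shapiro (k : nat) : {poly C} * {poly C} :=
  if k is j.+1 then
    let: (p, q) := rudin_shapiro j in (p + q * 'X^(2 ^ j), p - q * 'X^(2 ^ j))
  else (1, 1).

Lemma rudin_shapiro_coef0 k i : (2 ^ k <= i)%N ->
  (rudin_shapiro k).1`_i = 0 /\ (rudin_shapiro k).2`_i = 0.
Proof.
elim: k i => [|k ih] i.
  by rewrite expn0 => i0; rewrite /= coef1 gtn_eqF.
rewrite expnS mul2n -addnn => ki /=; case: (rudin_shapiro k) ih => p q /= ih.
have k1 : (2 ^ k <= i)%N by exact: leq_trans (leq_addr _ _) ki.
have k2 : (2 ^ k <= i - 2 ^ k)%N by rewrite leq_subRL.
rewrite coefB coefD !coefMXn ltnNge k1 /=.
by rewrite (ih _ k1).1 (ih _ k2).2 addr0 subr0.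
Qed.

Lemma rudin_shapiro_coef1 k i : (i < 2 ^ k)%N ->
  nrm (rudin_shapiro k).1`_i = 1 /\ nrm (rudin_shapiro k).2`_i = 1.
Proof.
elim: k i => [|k ih] i.
  by rewrite expn0 ltnS leqn0 => /eqP ->; rewrite /= coef1 eqxx nrm1.
rewrite expnS mul2n -addnn => ki /=.
have := @rudin_shapiro_coef0 k i; case: (rudin_shapiro k) ih => p q /= ih zero.
rewrite coefB coefD !coefMXn; have [ik|ik] := ltnP i (2 ^ k).
  by rewrite addr0 subr0; split; have [] := ih i ik.
have ik' : (i - 2 ^ k < 2 ^ k)%N by rewrite ltn_subLR.
rewrite (zero ik).1 add0r sub0r nrmN.
by split; have [] := ih _ ik'.
Qed.

(** The parallelogram law doubles [|P|^2 + |Q|^2] at each step; the factor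
    [z^(2^k)] only decreases the second term, so the bound holds on the whole
    closed disc and not merely on the circle. *)
Lemma rudin_shapiro_bound k z : nrm z <= 1 ->
  nrm (rudin_shapiro k).1.[z] ^+ 2 + nrm (rudin_shapiro k).2.[z] ^+ 2 <= 2 ^+ k.+1.
Proof.
move=> z1; elim: k => [|k ih]; first by rewrite /= hornerC nrm1 expr1n; lra.
move: ih => /=; case: (rudin_shapiro k) => p q /= ih.
rewrite !hornerD hornerN hornerM hornerXn parallelogram nrmM nrmX.
rewrite [2 ^+ k.+2]exprS ler_pM2l //; apply: le_trans ih.
rewrite lerD2l lerXn2r ?nnegrE ?mulr_ge0 ?exprn_ge0 ?nrm_ge0 //.
by rewrite ler_piMr ?nrm_ge0 // exprn_ile1 // nrm_ge0.
Qed.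

(** Only the polynomials of even index are used, so that all bounds are powers
    of 2 and no square root occurs. The exponents of the [j]-th block fill
    [4^j, 2 * 4^j), and these intervals are disjoint. *)
Definition rs_block (j : nat) : {poly C} :=
  toC (4 ^- j) *: ((rudin_shapiro (2 * j)).1 * 'X^(4 ^ j)).

Lemma exp4 j : (2 ^ (2 * j) = 4 ^ j)%N. Proof. by rewrite expnM. Qed.

Lemma rs_block_bound j z : nrm z <= 1 -> nrm (rs_block j).[z] <= 2 * (1 / 2) ^+ j.
Proof.
move=> z1; rewrite /rs_block hornerZ hornerM hornerXn !nrmM nrm_toC nrmX.
have p0 : 0 < (4 : R) ^+ j by rewrite exprn_gt0.
rewrite ger0_norm; last by rewrite invr_ge0 ltW.
have := rudin_shapiro_bound (2 * j) z1; move: (rudin_shapiro _).1.[z] => a h.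
have h2 : nrm a ^+ 2 <= (2 * 2 ^+ j) ^+ 2.
  have e1 : (2 : R) ^+ (2 * j).+1 = 2 * (2 ^+ j) ^+ 2 by rewrite exprS mulnC exprM.
  have := sqr_ge0 (nrm (rudin_shapiro (2 * j)).2.[z]).
  rewrite e1 in h; have := sqr_ge0 ((2 : R) ^+ j); rewrite [(2 * _) ^+ 2]exprMn; lra.
have h3 : nrm a <= 2 * 2 ^+ j.
  by move: h2; rewrite ler_pXn2r ?nnegrE ?nrm_ge0 // mulr_ge0 ?exprn_ge0.
apply: (@le_trans _ _ (4 ^- j * (2 * 2 ^+ j))).
  rewrite ler_wpM2l ?invr_ge0 ?(ltW p0) // (le_trans _ h3) //.
  by rewrite ler_piMr ?nrm_ge0 // exprn_ile1 // nrm_ge0.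
rewrite le_eqVlt; apply/orP; left; apply/eqP.
have -> : (4 : R) = 2 * 2 by ring.
by rewrite exprMn expr_div_n expr1n; field.
Qed.

Lemma rs_block_low j n : (n < 4 ^ j)%N -> (rs_block j)`_n = 0.
Proof. by move=> h; rewrite coefZ coefMXn h mulr0. Qed.

Lemma rs_block_high j n : (4 ^ j.+1 <= n)%N -> (rs_block j)`_n = 0.
Proof.
move=> h; rewrite coefZ coefMXn.
have h1 : (4 ^ j + 4 ^ j <= n)%N.
  by apply: leq_trans h; rewrite expnS addnn -mul2n leq_mul2r orbT.
have h2 : (4 ^ j <= n)%N by exact: leq_trans (leq_addr _ _) h1.
rewrite ltnNge h2 /= (rudin_shapiro_coef0 _).1 ?mulr0 //.
by rewrite exp4 leq_subRL.
Qed.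

Lemma rs_block_mid j i : (i < 4 ^ j)%N -> nrm (rs_block j)`_(4 ^ j + i) = 4 ^- j.
Proof.
move=> h; rewrite coefZ coefMXn ltnNge leq_addr /= addKn nrmM.
by rewrite (rudin_shapiro_coef1 _).1 ?exp4 // mulr1 nrm_toC ger0_norm.
Qed.

Lemma rs_block_coef_le j n : nrm (rs_block j)`_n <= (1 / 2) ^+ j.
Proof.
have q0 : (0 : R) <= 4 ^- j by rewrite invr_ge0 exprn_ge0.
have h : nrm (rs_block j)`_n <= 4 ^- j.
  rewrite coefZ coefMXn nrmM nrm_toC ger0_norm // ler_piMr //.
  case: ifP => _; first by rewrite nrm0.
  have [hl|hl] := ltnP (n - 4 ^ j) (2 ^ (2 * j)).
    by rewrite (rudin_shapiro_coef1 hl).1.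
  by rewrite (rudin_shapiro_coef0 hl).1 nrm0.
apply: (le_trans h); rewrite mul1r -exprVn lerXn2r ?nnegrE ?invr_ge0 //.
by rewrite lef_pV2 ?posrE //; lra.
Qed.

Definition rs_partial (m : nat) : {poly C} := \sum_(j < m) rs_block j.

Lemma rs_partial_high m n : (4 ^ m <= n)%N -> (rs_partial m)`_n = 0.
Proof.
move=> h; rewrite coef_sum big1 // => j _; apply: rs_block_high.
by apply: leq_trans h; rewrite leq_pexp2l.
Qed.

Lemma rs_partial_stable m k n : (n < 4 ^ m)%N ->
  (rs_partial (m + k))`_n = (rs_partial m)`_n.
Proof.
move=> h; elim: k => [|k ih]; first by rewrite addn0.
rewrite addnS /rs_partial big_ord_recr /= coefD -/(rs_partial _) ih.
rewrite rs_block_low ?addr0 //; apply: leq_trans h _.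
by rewrite leq_pexp2l // leq_addr.
Qed.

(** Any partial sum of index at least [n] has the same [n]-th coefficient, as
    [n < 4^n]. *)
Definition rs_coef (n : nat) : C := (rs_partial n)`_n.

Lemma rs_coefE m n : (n < 4 ^ m)%N -> (rs_partial m)`_n = rs_coef n.
Proof.
move=> h; have h' : (n < 4 ^ n)%N by exact: ltn_expl.
by rewrite /rs_coef -(rs_partial_stable n h) addnC rs_partial_stable.
Qed.

Lemma rs_coef_le n : nrm (rs_coef n) <= 2.
Proof.
rewrite /rs_coef /rs_partial coef_sum; apply: (le_trans (nrm_sum _ _ _)).
apply: (@le_trans _ _ (\sum_(j < n) (1 / 2) ^+ j)).
  by apply: ler_sum => j _; exact: rs_block_coef_le.
have := @geometric_sum_bound R (1 / 2) n ltac:(lra).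
by rewrite (_ : (1 - 1 / 2)^-1 = 2 :> R) //; field.
Qed.

Lemma rs_partialE m z : (rs_partial m).[z] = \sum_(n < 4 ^ m) rs_coef n * z ^+ n.
Proof.
rewrite (@horner_coef_wide _ (4 ^ m)).
  by apply: eq_bigr => n _; rewrite rs_coefE.
by apply/leq_sizeP => j; exact: rs_partial_high.
Qed.

(** Between [4^m] and [2 * 4^m] there are [4^m] coefficients of modulus [4^-m]. *)
Lemma rs_coef_sum_ge m : m%:R <= \sum_(n < 4 ^ m) nrm (rs_coef n).
Proof.
elim: m => [|m ih]; first by rewrite sumr_ge0 // => i _; exact: nrm_ge0.
have le4 : (4 ^ m + 4 ^ m <= 4 ^ m.+1)%N by rewrite expnS addnn -mul2n leq_mul2r orbT.
have [k Ek] : exists k, (4 ^ m.+1 = 4 ^ m + 4 ^ m + k)%N.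
  by exists (4 ^ m.+1 - (4 ^ m + 4 ^ m))%N; rewrite subnKC.
rewrite [in leRHS]Ek big_split_ord /= big_split_ord /=.
rewrite -natr1 -addrA; apply: lerD; first exact: ih.
rewrite -[leLHS]addr0; apply: lerD; last by rewrite sumr_ge0 // => i _; exact: nrm_ge0.
rewrite (eq_bigr (fun=> 4 ^- m)).
  rewrite sumr_const card_ord -[X in X <= _](mulVf (_ : (4 : R) ^+ m != 0)).
    by rewrite -[leRHS]mulr_natr natrX.
  by rewrite expf_neq0 // pnatr_eq0.
move=> i _; have lt : (4 ^ m + i < 4 ^ m.+1)%N.
  by apply: leq_trans le4; rewrite ltn_add2l.
rewrite -(rs_coefE lt) /rs_partial big_ord_recr /= coefD -/(rs_partial m).
by rewrite rs_partial_high ?leq_addr // add0r rs_block_mid.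
Qed.

Lemma radius_rs_coef : radius_ge rs_coef 1.
Proof.
move=> rho /andP[r0 r1]; exists 2 => n.
rewrite -[leRHS]mulr1 ler_pM ?nrm_ge0 ?exprn_ge0 ?rs_coef_le ?(ltW r0) //.
by rewrite exprn_ile1 // ltW.
Qed.

Lemma rs_sum_exists z : exists s, nrm z <= 1 -> is_sum (fun j => (rs_block j).[z]) s.
Proof.
have [z1|nz1] := pselect (nrm z <= 1); last by exists 0.
have [|s hs] := @is_sum_exists _ (fun j => (rs_block j).[z]) 2 (1 / 2) _ (fun j => rs_block_bound j z1).
  lra.
by exists s.
Qed.

(** Chosen pointwise as the sum of the blocks, hence arbitrary outside the
    closed disc. *)
Definition rs_fun z : C := projT1 (cid (rs_sum_exists z)).

Lemma rs_funP z : nrm z <= 1 -> is_sum (fun j => (rs_block j).[z]) (rs_fun z).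
Proof. by rewrite /rs_fun; case: cid. Qed.

Lemma rs_partial_sum m z : (rs_partial m).[z] = \sum_(j < m) (rs_block j).[z].
Proof. by rewrite /rs_partial horner_sum. Qed.

Lemma rs_tail m z : nrm z <= 1 ->
  nrm (rs_fun z - (rs_partial m).[z]) <= 4 * (1 / 2) ^+ m.
Proof.
move=> z1; apply: (@le_of_le_addM _ _ _ 1) => // e e0.
have [N hN] := rs_funP z1 e0.
have := hN (m + N)%N (leq_addl _ _); rewrite big_split_ord /= -rs_partial_sum.
set T := \sum_(j < N) _ => h.
have hT : nrm T <= 4 * (1 / 2) ^+ m.
  apply: (le_trans (nrm_sum _ _ _)).
  apply: (@le_trans _ _ (\sum_(j < N) 2 * (1 / 2) ^+ m * (1 / 2) ^+ j)).
    by apply: ler_sum => j _; rewrite -mulrA -exprD; exact: rs_block_bound.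
  rewrite -mulr_sumr; have := @geometric_sum_bound R (1 / 2) N ltac:(lra).
  rewrite (_ : (1 - 1 / 2)^-1 = 2 :> R); last by field.
  have : (0 : R) <= (1 / 2) ^+ m by rewrite exprn_ge0 //; lra.
  nra.
have := nrmD (rs_fun z - ((rs_partial m).[z] + T)) T.
have -> : rs_fun z - ((rs_partial m).[z] + T) + T = rs_fun z - (rs_partial m).[z] by ring.
lra.
Qed.

(** The partial sum of [m] blocks is the partial sum of length [4^m] of the power
    series, so that both series have the same limit. *)
Lemma rs_fun_pseries : has_pseries rs_coef rs_fun 1.
Proof.
move=> z z1; have [s hs] := pseries_sum radius_rs_coef z1.
suff -> : rs_fun z = s by exact: hs.
apply/eqP; rewrite -subr_eq0; apply/eqP/nrm_small => e e0.
have e20 : 0 < e / 2 by lra.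
have [N hN] := hs _ e20.
have [M hM] := @geometric_small R (1 / 2) (e / 8) ltac:(lra) ltac:(lra).
pose m := maxn N M.
have h1 := rs_tail m (ltW z1).
have h2 := hM m (leq_maxr _ _).
have h3 : (N <= 4 ^ m)%N.
  by apply: (leq_trans (leq_maxl N M)); apply: ltnW; exact: ltn_expl.
have := hN _ h3; rewrite -rs_partialE => h4.
have := nrmB (rs_fun z - (rs_partial m).[z]) (s - (rs_partial m).[z]).
have -> : rs_fun z - (rs_partial m).[z] - (s - (rs_partial m).[z]) = rs_fun z - s by ring.
lra.
Qed.

Lemma rs_fun_cder z : nrm z < 1 -> exists l, cder rs_fun z l.
Proof.
move=> z1; have [s hs] := pseries_sum (radius_ge_deriv radius_rs_coef) z1.
by exists s; exact: pseries_cder radius_rs_coef rs_fun_pseries z1 hs.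
Qed.

Lemma ccont_horner (p : {poly C}) z : ccont (fun w => p.[w]) z.
Proof.
elim/poly_ind: p => [|p c ih].
  rewrite (_ : (fun w => _) = fun=> 0); first exact: cder_cont (cder_cst 0 z).
  by apply/funext => w; rewrite horner0.
rewrite (_ : (fun w => _) = fun w => p.[w] * w + c).
  apply: ccontD; last exact: cder_cont (cder_cst c z).
  by apply: ccontM ih _; exact: cder_cont (cder_id z).
by apply/funext => w; rewrite hornerMXaddC.
Qed.

Lemma rs_fun_cont z : nrm z <= 1 -> forall e, 0 < e -> exists2 d, 0 < d &
  forall w, nrm w <= 1 -> nrm (w - z) < d -> nrm (rs_fun w - rs_fun z) <= e.
Proof.
move=> z1 e e0.
have [m hm] := @geometric_small R (1 / 2) (e / 16) ltac:(lra) ltac:(lra).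
have {}hm := hm m (leqnn _).
have e20 : 0 < e / 2 by lra.
have [d d0 hd] := @ccont_horner (rs_partial m) z _ e20.
exists d => // w w1 /hd h.
have hz := rs_tail m z1; have hw := rs_tail m w1.
set p := (rs_partial m).[z] in h hz; set q := (rs_partial m).[w] in h hw.
have := nrmB (rs_fun w - q + (q - p)) (rs_fun z - p).
have := nrmD (rs_fun w - q) (q - p).
have -> : rs_fun w - q + (q - p) - (rs_fun z - p) = rs_fun w - rs_fun z by ring.
lra.
Qed.

End RudinShapiro.

(** * The disc algebra *)

Lemma continuous_comb (T : topologicalType) (K : numFieldType) (u v : T -> K) (l : K) :
  continuous u -> continuous v -> continuous (fun t => u t + l * v t).
Proof.
by move=> cu cv t; apply: cvgD; [exact: cu|apply: cvgM; [exact: cvg_cst|exact: cv]].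
Qed.

Section Assembly.
Context {R : realType}.
Local Notation C := (Cplx R).
Implicit Types (F G : C -> C) (l w : C) (e : R).

Definition disc_holomorphic F := forall w, nrm w < 1 -> exists l, cder F w l.

Lemma disc_holomorphic_comb F G l : disc_holomorphic F -> disc_holomorphic G ->
  disc_holomorphic (fun w => F w + l * G w).
Proof.
move=> hF hG w w1; have [m dm] := hF w w1; have [n dn] := hG w w1.
by eexists; apply: cderD dm _; exact: (cderM (cder_cst l w) dn).
Qed.

Lemma cauchy_taylor_comb F G l n : disc_holomorphic F -> disc_holomorphic G ->
  cauchy_taylor (fun w => F w + l * G w) n = cauchy_taylor F n + l * cauchy_taylor G n.
Proof.
move=> hF hG; rewrite /cauchy_taylor mulrA -mulrDl; congr (_ / _).
have cc H : disc_holomorphic H -> square on_boundary (ccont (fun w => H w * w ^- n.+1)).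
  move=> hH; apply: on_square => w w1 w2; apply: ccontM.
    by have [m] := hH w w2; exact: cder_cont.
  by apply: ccont_invX; exact: neq0_of_half_le.
rewrite /cauchy_coef -square_integralZ; last exact: cc.
rewrite -square_integralD; first last.
- apply: on_square => w w1 w2; apply: (@ccontM _ (fun=> l)).
    exact: cder_cont (cder_cst l w).
  apply: ccontM; first by have [m] := hG w w2; exact: cder_cont.
  by apply: ccont_invX; exact: neq0_of_half_le.
- exact: cc.
by apply: eq_square_integral => w _ _; ring.
Qed.

Lemma eq_cauchy_taylor F G n : (forall w, nrm w < 1 -> F w = G w) ->
  cauchy_taylor F n = cauchy_taylor G n.
Proof.
move=> h; rewrite /cauchy_taylor /cauchy_coef; congr (_ / _).
by apply: eq_square_integral => w _ /h ->.
Qed.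

Lemma normed_seriesE (u : nat -> C) n :
  [normed series u] n = toC (\sum_(k < n) nrm (u k)).
Proof.
rewrite [LHS](_ : _ = series (fun k => `|u k|) n) //.
elim: n => [|n ih]; first by rewrite seriesEord /= !big_ord0.
by rewrite seriesSr big_ord_recr /= ih toCD -normE.
Qed.

Lemma l1P (u : nat -> C) : l1 u <-> exists B : R, forall n, \sum_(k < n) nrm (u k) <= B.
Proof.
have mono m n : (m <= n)%N -> \sum_(k < m) nrm (u k) <= \sum_(k < n) nrm (u k).
  move=> /subnKC <-; rewrite big_split_ord /= lerDl sumr_ge0 // => i _.
  exact: nrm_ge0.
split=> [|[B hB]].
  rewrite /l1 /= => cu.
  have := (@cvgrPdist_le _ _ _ \oo _ _ _).1 cu.
  move=> /(_ eventually_filter 1 ltr01) [N _]; move: (limn _) => s hN.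
  exists (nrm s + 1) => n; apply: (le_trans (mono n _ (leq_maxr N n))).
  have := hN (maxn N n) (leq_maxl N n).
  rewrite normed_seriesE normE -toC1 le_toC.
  set S := \sum_(k < _) _ => h.
  have S0 : 0 <= S by rewrite sumr_ge0 // => i _; exact: nrm_ge0.
  have := nrm_lbB (toC S) s; rewrite nrm_toC ger0_norm // nrmC; lra.
pose S n : R := \sum_(k < n) nrm (u k).
have cS : cvgn S.
  apply: nondecreasing_is_cvgn; first by move=> m n; exact: mono.
  by exists B => _ [n _ <-]; exact: hB.
apply/cvg_ex; exists (toC (limn S)).
apply/(@cvgrPdist_le _ _ _ \oo eventually_filter) => e e0.
have eE : e = toC (nrm e) by rewrite -normE gtr0_norm.
have e0' : 0 < nrm e by rewrite nrm_gt0 gt_eqF.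
move: cS => /cvgrPdist_le /(_ _ e0') [N _ hN]; exists N => // n /hN h.
by rewrite normed_seriesE -toCB normE [leRHS]eE le_toC nrm_toC.
Qed.

Lemma normr_lt1 (z : C) : (`|z| < 1) = (nrm z < 1).
Proof. by rewrite normE -toC1 lt_toC. Qed.
Lemma normr_le1 (z : C) : (`|z| <= 1) = (nrm z <= 1).
Proof. by rewrite normE -toC1 le_toC. Qed.

Definition disc_fun (f : disc_algebra R) : C -> C := extend (set_val f).

Lemma disc_fun_holomorphic (f : disc_algebra R) : disc_holomorphic (disc_fun f).
Proof.
move=> w w1; exists (derive1 (disc_fun f) w); apply: derivable_cder.
have [_ h] := set_valP f; apply: h.
by rewrite /unit_disc /= normr_lt1.
Qed.

Lemma extend_val (f : closed_unit_disc R -> C) (z : closed_unit_disc R) :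
  extend f (set_val z) = f z.
Proof.
have /(congr1 (fun h : closed_unit_disc R -> C => h z)) := @valLK _ _ 0 (closed_unit_disc R) f.
by [].
Qed.

Lemma disc_point w : nrm w <= 1 -> exists z : closed_unit_disc R, set_val z = w.
Proof.
move=> w1; have Dw : closed_unit_disc R w by rewrite /closed_unit_disc /= normr_le1.
by exists (exist _ w (mem_set Dw)).
Qed.

Lemma nrm_disc (z : closed_unit_disc R) : nrm (set_val z) <= 1.
Proof. by have := set_valP z; rewrite /closed_unit_disc /= normr_le1. Qed.

Lemma sup_norm_lt (h : closed_unit_disc R -> C) (e : R) (z : closed_unit_disc R) :
  (sup_norm h < e%:E)%E -> nrm (h z) <= e.
Proof.
move=> he; rewrite -lee_fin; apply: le_trans (ltW he).
by apply: ereal_sup_ubound; exists z.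
Qed.

Lemma sup_norm_le (h : closed_unit_disc R -> C) (e : R) :
  (forall z : closed_unit_disc R, nrm (h z) <= e) -> (sup_norm h <= e%:E)%E.
Proof. by move=> he; apply: ge_ereal_sup => _ [z _ <-]; rewrite lee_fin; exact: he. Qed.

Lemma disc_fun_dist (f g : disc_algebra R) (e : R) w :
  (sup_norm (fun z => set_val f z - set_val g z)%R < e%:E)%E ->
  nrm w <= 1 -> nrm (disc_fun f w - disc_fun g w) <= e.
Proof.
move=> h /disc_point[z <-]; rewrite /disc_fun !extend_val.
exact: (sup_norm_lt z h).
Qed.

Lemma taylor_coef_disc_fun (f : disc_algebra R) n :
  taylor_coef (disc_fun f) n = cauchy_taylor (disc_fun f) n.
Proof. by apply: taylor_coef_cauchy; exact: disc_fun_holomorphic. Qed.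

(** The Cauchy estimate for [f - g], the Taylor coefficients being linear on
    functions holomorphic in the disc. *)
Lemma taylor_dist (f g : disc_algebra R) (e : R) n :
  (sup_norm (fun z => set_val f z - set_val g z)%R < e%:E)%E ->
  nrm (taylor_coef (disc_fun f) n - taylor_coef (disc_fun g) n) <= e * cauchy_const n.
Proof.
move=> h; have -> : taylor_coef (disc_fun f) n - taylor_coef (disc_fun g) n =
    cauchy_taylor (fun w => disc_fun f w + (-1) * disc_fun g w) n.
  by rewrite cauchy_taylor_comb ?taylor_coef_disc_fun ?mulN1r //; exact: disc_fun_holomorphic.
apply: cauchy_taylor_bound; first by apply: disc_holomorphic_comb; exact: disc_fun_holomorphic.
by move=> w w1; rewrite mulN1r; apply: disc_fun_dist h _; exact: ltW.
Qed.

Lemma non_l1P (f : disc_algebra R) : non_l1_taylor R f <->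
  forall B : R, exists n, B < \sum_(k < n) nrm (taylor_coef (disc_fun f) k).
Proof.
rewrite /non_l1_taylor /= -/(disc_fun f); split=> [h B|h /l1P[B hB]].
  apply: contrapT => nh; apply: h; apply/l1P; exists B => n.
  by rewrite leNgt; apply/negP => hn; apply: nh; exists n.
by have [n] := h B; rewrite ltNge hB.
Qed.

(** A strict inequality for a finite sum of continuous functions of [f]. *)
Lemma open_taylor_sum (B : R) :
  open [set f : disc_algebra R | exists n, B < \sum_(k < n) nrm (taylor_coef (disc_fun f) k)].
Proof.
rewrite openE => f /= [n hn]; apply/nbhs_disc_algebra.
pose K : R := \sum_(k < n) cauchy_const k + 1.
have K0 : 0 < K.
  rewrite ltr_wpDl // sumr_ge0 // => k _; exact: ltW (cauchy_const_gt0 k).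
exists ((\sum_(k < n) nrm (taylor_coef (disc_fun f) k) - B) / K).
  by rewrite divr_gt0 // subr_gt0.
set S := \sum_(k < n) _ in hn *; set e := _ / K => g hg; exists n.
have eK : e * K = S - B by rewrite /e divfK // gt_eqF.
have e0 : 0 < e by rewrite /e divr_gt0 // subr_gt0.
have : S <= \sum_(k < n) nrm (taylor_coef (disc_fun g) k) + e * (K - 1).
  rewrite /K addrK mulr_sumr -big_split /=; apply: ler_sum => k _.
  have := taylor_dist k hg.
  have := nrm_lbB (taylor_coef (disc_fun f) k) (taylor_coef (disc_fun g) k); lra.
rewrite mulrBr mulr1 eK; lra.
Qed.

Lemma Gdelta_non_l1 : Gdelta (non_l1_taylor R).
Proof.
exists (fun N : nat => [set f : disc_algebra R |
    exists n, N%:R < \sum_(k < n) nrm (taylor_coef (disc_fun f) k)]).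
  by move=> N; exact: open_taylor_sum.
apply/seteqP; split=> f.
  by move=> /non_l1P h N _; exact: h.
move=> h; apply/non_l1P => B.
have [n hn] := h (Num.truncn B).+1 I.
by exists n; apply: lt_trans hn; exact: truncnS_gt.
Qed.

Section Perturbation.
Context (f : disc_algebra R) (l : C).

Let h : {uniform closed_unit_disc R -> Cplx R} :=
  fun z : closed_unit_disc R => set_val f z + l * rs_fun (set_val z).

Lemma perturb_extend w : nrm w <= 1 -> extend h w = disc_fun f w + l * rs_fun w.
Proof. by move=> /disc_point[z <-]; rewrite /disc_fun !extend_val. Qed.

Lemma perturb_disc_algebra : disc_algebra R h.
Proof.
have [cf df] := set_valP f; split.
  have cr : continuous (fun z : closed_unit_disc R => rs_fun (set_val z) : C).
    move=> z; apply/(@cvgrPdist_le _ _ _ (nbhs z) (nbhs_filter z)) => e e0.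
    have eE : e = toC (nrm e) by rewrite -normE gtr0_norm.
    have e0' : 0 < nrm e by rewrite nrm_gt0 gt_eqF.
    have [d d0 hd] := rs_fun_cont (nrm_disc z) e0'.
    have nb : nbhs (set_val z : C) [set w : C | nrm (w - set_val z) < d].
      apply/nbhs_ballP; exists (toC d); first by rewrite /= -toC0 lt_toC.
      by move=> w; rewrite /ball /= distrC normE lt_toC.
    have nz : nbhs z (set_val @^-1` [set w : C | nrm (w - set_val z) < d]).
      exact: (@initial_continuous (closed_unit_disc R) _ set_val z _ nb).
    apply: (@filterS _ (nbhs z) (nbhs_filter z) _ _ _ nz) => w /= hw.
    by rewrite distrC normE [leRHS]eE le_toC; apply: hd => //; exact: nrm_disc.
  exact: (continuous_comb (l := l) cf cr).
move=> w; rewrite /unit_disc /= normr_lt1 => w1.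
have [m dm] := disc_holomorphic_comb l (disc_fun_holomorphic f) (@rs_fun_cder R) w1.
apply: (proj1 (cder_derivable (l := m) _)).
apply: eq_near_cder dm; exists (1 - nrm w); first by rewrite subr_gt0.
move=> v vw; rewrite perturb_extend //.
by have := nrmD (v - w) w; rewrite subrK; lra.
Qed.

Definition perturb : disc_algebra R := exist _ h (mem_set perturb_disc_algebra).

Lemma perturb_taylor n :
  taylor_coef (disc_fun perturb) n = taylor_coef (disc_fun f) n + l * rs_coef n.
Proof.
rewrite !taylor_coef_disc_fun.
rewrite (@eq_cauchy_taylor _ (fun w => disc_fun f w + l * rs_fun w)); last first.
  by move=> w w1; rewrite /disc_fun perturb_extend // ltW.
rewrite cauchy_taylor_comb; [|exact: disc_fun_holomorphic|exact: rs_fun_cder].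
rewrite -(@taylor_coef_cauchy _ rs_fun); last exact: rs_fun_cder.
by rewrite (taylor_coef_pseries n ltr01 radius_rs_coef rs_fun_pseries).
Qed.

(** The tail estimate [rs_tail] with no block removed says [|rs_fun| <= 4]. *)
Lemma perturb_dist : (sup_norm (fun z => set_val f z - set_val perturb z)%R
  <= (4 * nrm l)%:E)%E.
Proof.
apply: sup_norm_le => z /=.
have -> : set_val f z - h z = - (l * rs_fun (set_val z)).
  by rewrite /h opprD addrA subrr add0r.
rewrite nrmN nrmM mulrC ler_wpM2r ?nrm_ge0 //.
have := rs_tail 0 (nrm_disc z).
by rewrite /rs_partial big_ord0 horner0 subr0 expr0 mulr1.
Qed.

End Perturbation.

(** If [beta(f)] is in [l^1], then [beta(f + l g)] is not, since
    [|l beta_k(g)| <= |beta_k(f + l g)| + |beta_k(f)|]. *)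
Lemma dense_non_l1 : dense (non_l1_taylor R).
Proof.
move=> O [f Of] oO.
have [nf|lf] := pselect (non_l1_taylor R f); first by exists f.
have : nbhs f O by exact: open_nbhs_nbhs.
move=> /nbhs_disc_algebra[e e0 eO].
pose l : C := toC (e / 8).
have nl : nrm l = e / 8 by rewrite nrm_toC ger0_norm //; lra.
exists (perturb f l); split.
  apply: eO; apply: le_lt_trans (perturb_dist f l) _.
  by rewrite lte_fin nl; lra.
apply/non_l1P => B.
have /l1P[A hA] : l1 (taylor_coef (disc_fun f)) by exact: contrapT lf.
pose m := (Num.truncn ((A + B) / (e / 8))).+1.
exists (4 ^ m)%N.
have hm : A + B < e / 8 * m%:R.
  rewrite mulrC -ltr_pdivrMr; last lra.
  exact: truncnS_gt.
have := rs_coef_sum_ge (R := R) m.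
set S := \sum_(n < _) nrm (rs_coef n) => hS.
have hS' : e / 8 * m%:R <= e / 8 * S by rewrite ler_wpM2l //; lra.
have : e / 8 * S <= \sum_(k < 4 ^ m) nrm (taylor_coef (disc_fun (perturb f l)) k)
   + \sum_(k < 4 ^ m) nrm (taylor_coef (disc_fun f) k).
  rewrite /S mulr_sumr -big_split /=; apply: ler_sum => k _.
  rewrite perturb_taylor -nl -nrmM.
  have := nrmB (taylor_coef (disc_fun f) k + l * rs_coef k) (taylor_coef (disc_fun f) k).
  by rewrite addrAC subrr add0r.
have := hA (4 ^ m)%N; lra.
Qed.

End Assembly.

Theorem theorem3p5 (R : realType) :
  Gdelta (non_l1_taylor R) /\ dense (non_l1_taylor R).
Proof. by split; [exact: Gdelta_non_l1|exact: dense_non_l1]. Qed.
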